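(* Let $\pi$ be a plane of $\mathrm{PG}(8,q)$ fixed by $\sigma$. Then $\pi$ is exactly one of the following types: - $\pi$ is a ptwise-fixed plane; - $\pi$ is an $\mathbb S_{\mathrm I}$-plane; - $\pi$ contains at least one II$_{.:}$-point, in which case $\pi$ lies in a unique $\mathbb H_{\mathrm I}$-5-space (a fixed-II-plane); - $\pi$ contains at least one III$_{.:}$-point (a fixed-III-plane); - $\pi$ is contained in a hwise-fixed-5-space and is not fixed pointwise (an h-plane).
   Context: Let $q>2$ be a prime power. Let $\phi$ be a collineation of $\mathrm{PG}(2,q^3)$ of order 3 fixing pointwise an $\mathbb F_q$-subplane $\mathcal P_{2,q}$. A point $\bar P$ of $\mathrm{PG}(2,q^3)$ has Type I if in $\mathcal P_{2,q}$, Type II if $\bar P,\bar P^\phi,\bar P^{\phi^2}$ are distinct and collinear, Type III if non-collinear; a Type-I-line meets $\mathcal P_{2,q}$ in $q+1$ points. Bose representation: identifying $\mathbb F_{q^3}^3$ with $\mathbb F_q^9$, each point $\bar P$ corresponds to a plane $[\![P]\!]$ of $\mathrm{PG}(8,q)$ ($\mathbb S_X$-plane if $\bar P$ has Type X), each line to the 5-space spanned by the planes of its points ($\mathbb H_{\mathrm I}$-5-space if it is a Type-I-line). A point is an X-point if it lies in an $\mathbb S_X$-plane. $\phi$ induces a projectivity $\sigma$ of $\mathrm{PG}(8,q)$ of order 3 with $[\![P]\!]^\sigma=[\![P^\phi]\!]$. A II-point $B$ is a II$_{.:}$-point if $B,B^\sigma,B^{\sigma^2}$ form a triangle; every III-point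 is called a III$_{.:}$-point. A ptwise-fixed plane is a plane fixed pointwise by $\sigma$. A hwise-fixed-5-space is a 5-space $\Pi$ such that every 6-space containing $\Pi$ is fixed by $\sigma$. *)

(* Defs.v *)
From HB Require Import structures.
From mathcomp Require Import all_boot all_order all_algebra all_field.

Set Implicit Arguments.
Unset Strict Implicit.
Unset Printing Implicit Defensive.

Import GRing.Theory.
Local Open Scope ring_scope.

(* PG(n, K) is the lattice of subspaces of 'rV[K]_n.+1: a projective subspace
   of dimension d is a {vspace 'rV[K]_n.+1} U with \dim U = d.+1. *)

Definition pg_point (K : fieldType) (n : nat) :=
  {P : {vspace 'rV[K]_n.+1} | \dim P == 1%N}.

Definition collinear (K : fieldType) (n : nat) (A B C : {vspace 'rV[K]_n.+1}) :=
  (\dim (A + B + C) <= 2)%N.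

Definition collineation (K : fieldType) (n : nat)
    (f : pg_point K n -> pg_point K n) : Prop :=
  bijective f /\
  forall P Q R,
    collinear (val (f P)) (val (f Q)) (val (f R))
    = collinear (val P) (val Q) (val R).

Definition has_order (T : Type) (f : T -> T) (n : nat) : Prop :=
  [/\ (0 < n)%N, iter n f =1 id
    & forall k, (0 < k < n)%N -> ~ (iter k f =1 id)].

(* The pred A has exactly n elements; its carrier need not be a finType. *)
Definition has_card (T : eqType) (A : pred T) (n : nat) : Prop :=
  exists s : seq T, [/\ uniq s, size s = n & s =i A].

Section CubicPlane.

(* F = F_q and L = F_{q^3}. *)
Variables (F : finFieldType) (L : fieldExtType F).

(* For b in GL_3(L), the F_q-subplane of PG(2,q^3) whose points are spanned by
   the nonzero F-linear combinations of the rows of b. As \dim (val P) = 1, the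
   zero combination does not contribute. *)
Definition subplane (b : 'M[L]_3) : pred (pg_point L 2) :=
  fun P => [exists c : 'rV[F]_3,
              val P == <[map_mx (in_alg L) c *m b]>%VS].

Section Types.

Variables (b : 'M[L]_3) (phi : pg_point L 2 -> pg_point L 2).

Definition typeI (P : pg_point L 2) : Prop := subplane b P.

Definition typeII (P : pg_point L 2) : Prop :=
  uniq [:: P; phi P; phi (phi P)]
  /\ collinear (val P) (val (phi P)) (val (phi (phi P))).

Definition typeIII (P : pg_point L 2) : Prop :=
  ~ collinear (val P) (val (phi P)) (val (phi (phi P))).

Definition typeI_line (l : {vspace 'rV[L]_3}) : Prop :=
  \dim l = 2%N
  /\ has_card (fun P => subplane b P && (val P <= l)%VS) #|F|.+1.

End Types.

Section Bose.

(* The identification of L^3 with F^9 expands each coordinate in an F-basis e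
   of L. *)
Variable e : 3.-tuple L.

Definition bose (v : 'rV[L]_3) : 'rV[F]_9 :=
  mxvec (\matrix_(i < 3, j < 3) coord e j (v 0 i)).

(* The plane [[P]], i.e. the image of P under the identification: see
   mem_bose_plane. *)
Definition bose_plane (P : pg_point L 2) : {vspace 'rV[F]_9} :=
  <<[seq bose (a *: vpick (val P)) | a <- e]>>%VS.

Lemma bose_linear (a : F) (u v : 'rV[L]_3) :
  bose (a%:A *: u + v) = a *: bose u + bose v.
Proof.
rewrite /bose.
set A := \matrix_(i, j) coord e j (u 0 i); set B := \matrix_(i, j) coord e j (v 0 i).
transitivity (mxvec (a *: A + B)); last exact: (linearP (@mxvec F 3 3) a A B).
apply: (congr1 (@mxvec F 3 3)); apply/matrixP=> i j.
by rewrite !mxE mulr_algl linearP.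
Qed.

Lemma mem_bose_plane (P : pg_point L 2) (x : 'rV[F]_9) :
  basis_of fullv e ->
  x \in bose_plane P <-> exists2 v, v \in val P & x = bose v.
Proof.
move=> ebas.
have b0 : bose 0 = 0.
  have := bose_linear 1 0 0; rewrite !scale1r addr0 => h.
  by apply: (addIr (bose 0)); rewrite add0r -h.
have bsum (I : finType) (c : I -> F) (f : I -> 'rV[L]_3) :
    bose (\sum_i (c i)%:A *: f i) = \sum_i c i *: bose (f i).
  elim/big_rec2: _ => [|i y z _ <-]; first exact: b0.
  by rewrite bose_linear.
have bexp (c : 'I_3 -> F) (w : 'rV[L]_3) :
    bose ((\sum_i c i *: e`_i) *: w) = \sum_i c i *: bose (e`_i *: w).
  rewrite -bsum scaler_suml; congr bose; apply: eq_bigr => i _.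
  by rewrite -[in LHS](mulr_algl (c i)) scalerA.
have Pline : val P = <[vpick (val P)]>%VS.
  have wn0 : vpick (val P) != 0.
    by rewrite vpick0; apply: contraTneq (valP P) => ->; rewrite dimv0.
  apply/esym/eqP.
  by rewrite eqEdim -memvE memv_pick (eqP (valP P)) dim_vline wn0.
set w := vpick (val P) in Pline *.
have sz : size [seq bose (a *: w) | a <- e] == 3 by rewrite size_map size_tuple.
have nthT (i : 'I_3) : (Tuple sz)`_i = bose (e`_i *: w).
  by rewrite /= (nth_map 0) ?size_tuple.
rewrite /bose_plane -/w; split.
  move=> xin; have /coord_span -> : x \in <<Tuple sz>>%VS by [].
  exists ((\sum_i coord (Tuple sz) i x *: e`_i) *: w).
    by rewrite Pline memvZ ?memv_line.
  by rewrite bexp; apply: eq_bigr => i _; rewrite nthT.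
case=> v; rewrite Pline => /vlineP [k ->] ->.
rewrite (coord_basis ebas (memvf k)) bexp.
apply: memv_suml => i _; apply: memvZ; apply: memv_span.
by apply/mapP; exists e`_i; rewrite ?mem_nth ?size_tuple.
Qed.

(* Pi is the span of the planes [[P]] of the points P of the line l. *)
Definition bose_line (l : {vspace 'rV[L]_3}) (Pi : {vspace 'rV[F]_9}) : Prop :=
  (forall P, (val P <= l)%VS -> (bose_plane P <= Pi)%VS)
  /\ (forall S : {vspace 'rV[F]_9},
        (forall P, (val P <= l)%VS -> (bose_plane P <= S)%VS) -> (Pi <= S)%VS).

Variables (b : 'M[L]_3) (phi : pg_point L 2 -> pg_point L 2).

Definition SI_plane (U : {vspace 'rV[F]_9}) : Prop :=
  exists2 P, typeI b P & U = bose_plane P.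

Definition SII_plane (U : {vspace 'rV[F]_9}) : Prop :=
  exists2 P, typeII phi P & U = bose_plane P.

Definition SIII_plane (U : {vspace 'rV[F]_9}) : Prop :=
  exists2 P, typeIII phi P & U = bose_plane P.

Definition HI_5space (Pi : {vspace 'rV[F]_9}) : Prop :=
  exists2 l, typeI_line b l & bose_line l Pi.

Definition II_point (B : pg_point F 8) : Prop :=
  exists2 U, SII_plane U & (val B <= U)%VS.

Definition III_point (B : pg_point F 8) : Prop :=
  exists2 U, SIII_plane U & (val B <= U)%VS.

(* A projectivity of PG(8,q), given by an invertible linear map and acting on
   subspaces. *)
Variable sigma : 'End('rV[F]_9).

Definition II_triangle_point (B : pg_point F 8) : Prop :=
  II_point B
  /\ ~ collinear (val B) (sigma @: val B) (sigma @: (sigma @: val B)).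

Definition III_triangle_point (B : pg_point F 8) : Prop := III_point B.

Definition ptwise_fixed (U : {vspace 'rV[F]_9}) : Prop :=
  forall B : pg_point F 8, (val B <= U)%VS -> (sigma @: val B)%VS = val B.

Definition hwise_fixed_5space (Pi : {vspace 'rV[F]_9}) : Prop :=
  \dim Pi = 6%N
  /\ forall S : {vspace 'rV[F]_9},
       \dim S = 7%N -> (Pi <= S)%VS -> (sigma @: S)%VS = S.

Inductive fixed_plane_kind :=
  PtwiseFixed | SIPlane | FixedII | FixedIII | HPlane.

Definition plane_of_kind (pi : {vspace 'rV[F]_9}) (k : fixed_plane_kind) : Prop :=
  match k with
  | PtwiseFixed => ptwise_fixed pi
  | SIPlane => SI_plane pi
  | FixedII => exists2 B, II_triangle_point B & (val B <= pi)%VS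
  | FixedIII => exists2 B, III_triangle_point B & (val B <= pi)%VS
  | HPlane =>
      (exists2 Pi, hwise_fixed_5space Pi & (pi <= Pi)%VS) /\ ~ ptwise_fixed pi
  end.

End Bose.

End CubicPlane.

(* Main.v *)
Require Import Defs.
From HB Require Import structures.
From mathcomp Require Import all_boot all_order all_algebra all_field.
From mathcomp Require Import ring.

Set Implicit Arguments.
Unset Strict Implicit.
Unset Printing Implicit Defensive.

Import GRing.Theory.
Local Open Scope ring_scope.

(** In the coordinates of L^3 given by the rows of b, sigma acts on each
    coordinate by the same F-linear map t, because it fixes the points of the
    frame formed by the rows and their sum; as sigma permutes the L-lines,
    t = t(1) tau for an automorphism tau of L over F, of order 3. Hence
    sigma^3 is a scalar n. Call v cyclic if v, sigma v, sigma^2 v are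
    F-independent. A fixed plane with a cyclic vector v is spanned by
    v, sigma v, sigma^2 v, and the dimension 1, 2 or 3 of the L-span of these
    vectors tells whether it is an S_I-plane, a fixed-II-plane or a
    fixed-III-plane. On a fixed plane without cyclic vector sigma is either
    a scalar or satisfies sigma^2 + c sigma + c^2 = 0 with c^3 = n, and the
    kernel of the latter operator is the image of sigma - c; these images are
    exactly the hwise-fixed 5-spaces. *)

(** * Linear algebra: sums of lines, maps that are scalar modulo a subspace *)

Lemma eq_by_scalars (K : fieldType) (V : vectType K) (u v : V) :
  (forall g : V -> K, g 0 = 0 -> {morph g : x / - x} -> {morph g : x y / x + y} ->
     (forall k x, g (k *: x) = k * g x) -> g u = g v) -> u = v.
Proof.
move=> guv; rewrite (coord_vbasis (memvf u)) (coord_vbasis (memvf v)).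
apply: eq_bigr => i _; congr (_ *: _); apply: guv; first exact: linear0.
- exact: linearN.
- exact: linearD.
- by move=> k x; rewrite linearZ.
Qed.

(** Proves an identity between linear combinations by applying an arbitrary linear functional [g],
    which turns it into a scalar identity for [ring]. *)
Ltac vect_ring :=
  let g := fresh "g" in let g0 := fresh "g0" in let gN := fresh "gN" in
  let gD := fresh "gD" in let gZ := fresh "gZ" in
  apply: eq_by_scalars => g g0 gN gD gZ /=; rewrite ?(gD, gN, gZ, g0); ring.

Lemma dim_addv_line (K : fieldType) (V : vectType K) (U : {vspace V}) u :
  u \notin U -> \dim (U + <[u]>)%VS = (\dim U).+1.
Proof.
move=> uU; rewrite dimv_disjoint_sum ?dim_vline.
  by case: eqP uU => [-> | _ _]; rewrite ?mem0v ?addn1.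
apply/eqP; rewrite -subv0; apply/subvP=> w; rewrite memv_cap => /andP[wU /vlineP[k wE]].
rewrite memv0 wE scaler_eq0; apply: contraNT uU; rewrite negb_or => /andP[k0 _].
by rewrite -(scalerK k0 u) -wE memvZ.
Qed.

Lemma dim_add_lines (K : fieldType) (V : vectType K) (x y : V) :
  x != 0 -> y \notin <[x]>%VS -> \dim (<[x]> + <[y]>)%VS = 2%N.
Proof. by move=> x0 yx; rewrite dim_addv_line // dim_vline x0. Qed.

Lemma memv_add_lines (K : fieldType) (V : vectType K) (u x y : V) :
  reflect (exists k m, u = k *: x + m *: y) (u \in <[x]> + <[y]>)%VS.
Proof.
apply: (iffP idP) => [/memv_addP[_ /vlineP[k ->] [_ /vlineP[m ->] ->]] | [k [m ->]]].
  by exists k, m.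
by rewrite memv_add ?memvZ ?memv_line.
Qed.

Section ScalarModulo.

Variables (K : fieldType) (V : vectType K) (f : 'End(V)) (U X : {vspace V}).

(** In the quotient by [U] every vector of [X] is an eigenvector, so all eigenvalues agree. The
    argument is run without the quotient: each [v] is compared with a fixed [v0] outside [U] by
    means of [v0 + v]. *)
Lemma scalar_modulo :
  {in U, forall v, f v \in U} -> {in X, forall v, f v \in U + <[v]>}%VS ->
  exists c, {in X, forall v, f v - c *: v \in U}.
Proof.
move=> fU fX.
have fXE v : v \in X -> exists k, f v - k *: v \in U.
  move=> /fX /memv_addP[u uU [w /vlineP[k ->]] ->]; exists k.
  by rewrite addrK.
have [XU | /subvPn[v0 v0X v0U]] := boolP (X <= U)%VS.
  by exists 0 => v /(subvP XU) vU; rewrite scale0r subr0 fU.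
have [c fv0] := fXE _ v0X; exists c => v vX.
have [vU | vU] := boolP (v \in U); first by rewrite memvB ?memvZ ?fU.
have [k fv] := fXE _ vX; have [m fw] := fXE _ (memvD v0X vX).
(* The eigenvalues of [v0], [v] and [v0 + v] modulo [U] are [c], [k] and [m]. *)
have comb : (c - m) *: v0 + (k - m) *: v \in U.
  have -> : (c - m) *: v0 + (k - m) *: v =
      (f (v0 + v) - m *: (v0 + v)) - (f v0 - c *: v0) - (f v - k *: v).
    by rewrite linearD; vect_ring.
  by rewrite memvB // memvB.
have [ekm | nkm] := eqVneq k m.
  move: comb; rewrite ekm subrr scale0r addr0 => cU.
  have [cm | ncm] := eqVneq c m; first by rewrite cm -ekm.
  case/negP: v0U; rewrite -[v0](scalerK (a := c - m)) ?subr_eq0 //.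
  exact: memvZ.
(* Here [v] is a multiple of [v0] modulo [U], so it inherits the eigenvalue [c]. *)
have km0 : k - m != 0 by rewrite subr_eq0.
pose r := (c - m) / (k - m).
have vr : v + r *: v0 \in U.
  have -> : v + r *: v0 = (k - m)^-1 *: ((c - m) *: v0 + (k - m) *: v).
    by rewrite scalerDr !scalerA mulVf // scale1r addrC mulrC.
  exact: memvZ.
have -> : f v - c *: v = f (v + r *: v0) - c *: (v + r *: v0) - r *: (f v0 - c *: v0).
  have -> : f (v + r *: v0) = f v + r *: f v0 by rewrite linearD linearZ.
  by move: r {vr} => r; vect_ring.
by rewrite memvB ?memvZ // memvB ?memvZ ?fU.
Qed.

End ScalarModulo.

(** * Operators whose cube is a scalar *)

Section CubeRoot.

Variables (K : fieldType) (V : vectType K) (f : 'End(V)) (n : K).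
Hypothesis f3 : forall v, f (f (f v)) = n *: v.

Definition cyclic_vector v := free [:: f (f v); f v; v].

(* For c ^ 3 = n, the cofactor of f - c in the factorization of f ^ 3 - n. *)
Definition cube_cofactor c v := f (f v) + c *: f v + c ^+ 2 *: v.

(** The condition that [v] is nonzero is absorbed, since [f 0] lies in the zero line. *)
Lemma cyclic_vectorE v :
  cyclic_vector v = (f (f v) \notin <[f v]> + <[v]>)%VS && (f v \notin <[v]>%VS).
Proof.
rewrite /cyclic_vector !free_cons span_cons !span_seq1 span_nil memv0 nil_free andbT.
congr (_ && _); apply: andb_idr; apply: contraNneq => ->.
by rewrite linear0 mem0v.
Qed.

Lemma cyclic_vector_dim v :
  cyclic_vector v = (2 < \dim (<[v]> + <[f v]> + <[f (f v)]>))%N.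
Proof.
have <- : <<[:: f (f v); f v; v]>>%VS = (<[v]> + <[f v]> + <[f (f v)]>)%VS.
  by rewrite !span_cons span_nil addv0 addvC [(_ + <[v]>)%VS]addvC.
by rewrite /cyclic_vector /free eqn_leq dim_span.
Qed.

Lemma cyclic_span (X : {vspace V}) v : cyclic_vector v -> \dim X = 3%N ->
  v \in X -> {in X, forall w, f w \in X} -> X = (<[v]> + <[f v]> + <[f (f v)]>)%VS.
Proof.
rewrite cyclic_vector_dim => dv dX vX fX.
by apply/esym/eqP; rewrite eqEdim dX dv !subv_add -!memvE vX !fX ?fX.
Qed.

Lemma cofactor_noncyclic c v : cube_cofactor c v = 0 -> ~~ cyclic_vector v.
Proof.
move=> /eqP; rewrite /cube_cofactor -addrA addr_eq0 cyclic_vectorE => /eqP ->.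
by rewrite memvN memv_add ?memvZ ?memv_line.
Qed.

Lemma eigen_noncyclic v : f v \in <[v]>%VS -> ~~ cyclic_vector v.
Proof. by rewrite cyclic_vectorE andbC => ->. Qed.

(** The minimal polynomial of [v] is a quadratic X^2 - k X - m dividing X^3 - n. Comparing
    coefficients gives k^2 + m = 0 and n = k m, and the remaining linear factor is X + k, whence c =
    - k. *)
Lemma noncyclic_cofactor v : ~~ cyclic_vector v -> f v \notin <[v]>%VS ->
  exists2 c, c ^+ 3 = n & cube_cofactor c v = 0.
Proof.
rewrite cyclic_vectorE => cv fv; move: cv; rewrite fv andbT negbK.
case/memv_addP=> _ /vlineP[k ->] [_ /vlineP[m ->]] ffv.
have e0 : (k ^+ 2 + m) *: f v = (n - k * m) *: v.
  have := f3 v; rewrite {1}ffv linearD !linearZ /= ffv => fffv.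
  apply: (addIr (k * m *: v)); rewrite -scalerDl subrK -fffv.
  by rewrite scalerDr !scalerA -expr2 scalerDl addrAC.
have k2 : k ^+ 2 + m = 0.
  apply/eqP; apply: contraNT fv => nz.
  by apply/vlineP; exists ((k ^+ 2 + m)^-1 * (n - k * m)); rewrite -scalerA -e0 scalerK.
have nkm : n = k * m.
  move: e0; rewrite k2 scale0r => /esym/eqP; rewrite scaler_eq0 subr_eq0.
  case/orP=> /eqP // v0; case/negP: fv; rewrite v0 linear0; exact: mem0v.
have mE : m = - k ^+ 2 by apply/eqP; rewrite -addr_eq0 addrC k2.
exists (- k); first by rewrite nkm mE; ring.
by rewrite /cube_cofactor ffv mE sqrrN; vect_ring.
Qed.

Lemma cofactorD c u v : cube_cofactor c (u + v) = cube_cofactor c u + cube_cofactor c v.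
Proof.
rewrite /cube_cofactor !linearD /=.
by vect_ring.
Qed.

Lemma cofactorZ c k v : cube_cofactor c (k *: v) = k *: cube_cofactor c v.
Proof.
rewrite /cube_cofactor !linearZ /=.
by vect_ring.
Qed.

Lemma cofactor0 c : cube_cofactor c 0 = 0.
Proof. by rewrite -[X in cube_cofactor _ X](scale0r 0) cofactorZ scale0r. Qed.

Lemma cofactor_comm c v : f (cube_cofactor c v) = cube_cofactor c (f v).
Proof. by rewrite /cube_cofactor !linearD !linearZ. Qed.

Lemma cofactor_lfunE c v :
  cube_cofactor c v = (f \o f + c *: f + c ^+ 2 *: \1)%VF v.
Proof. by rewrite !add_lfunE !scale_lfunE comp_lfunE id_lfunE. Qed.

(** This is (f - c)(f^2 + c f + c^2) = f^3 - n = 0. *)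
Lemma cofactor_eigen c v : c ^+ 3 = n -> f (cube_cofactor c v) = c *: cube_cofactor c v.
Proof.
move=> cn; rewrite /cube_cofactor !linearD !linearZ /= f3 -cn.
by vect_ring.
Qed.

Lemma cofactor_sub c v : c ^+ 3 = n -> cube_cofactor c (f v - c *: v) = 0.
Proof.
move=> cn; rewrite -scaleNr cofactorD cofactorZ -cofactor_comm cofactor_eigen //.
by rewrite scaleNr subrr.
Qed.

Lemma cofactor_eigenvalue c d v : f v = d *: v ->
  cube_cofactor c v = (d ^+ 2 + c * d + c ^+ 2) *: v.
Proof.
by move=> fv; rewrite /cube_cofactor fv linearZ /= fv !scalerA -!scalerDl expr2.
Qed.

(* If 3 <> 0, adding a nonzero value of the cofactor of c to a vector that it
   kills gives a cyclic vector; if 3 = 0, c is the only cube root of n. *)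
Lemma noncyclic_space (X : {vspace V}) v0 : n != 0 -> {in X, forall v, f v \in X} ->
  {in X, forall v, ~~ cyclic_vector v} -> v0 \in X -> f v0 \notin <[v0]>%VS ->
  exists2 c, c ^+ 3 = n & {in X, forall v, cube_cofactor c v = 0}.
Proof.
move=> n0 fX ncX v0X fv0; have [c cn cv0] := noncyclic_cofactor (ncX _ v0X) fv0.
have c0 : c != 0 by apply: contraNneq n0 => c0; rewrite -cn c0 expr0n.
exists c => // w wX; apply/eqP; apply/negP=> /negP w'0.
pose w' := cube_cofactor c w; have fw' : f w' = c *: w' by apply: cofactor_eigen.
have w'X : w' \in X by rewrite /w' /cube_cofactor !memvD ?memvZ ?fX // fX.
have [three0 | three0] := eqVneq (3%:R : K) 0.
  (* In characteristic 3 cubing is additive, hence injective. *)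
  have croot d : d ^+ 3 = n -> d = c.
    move=> dn; apply/eqP; rewrite -subr_eq0; have: (d - c) ^+ 3 = 0.
      transitivity (d ^+ 3 - c ^+ 3 + 3%:R * (d * c ^+ 2 - d ^+ 2 * c)); first by ring.
      by rewrite three0 mul0r dn cn subrr addr0.
    by move=> /eqP; rewrite expf_eq0.
  have [/vlineP[d fw] | nfw] := boolP (f w \in <[w]>%VS).
    have wn0 : w != 0.
      by apply: contraNneq w'0 => ->; rewrite cofactor0.
    have dn : d ^+ 3 = n.
      have /eqP := f3 w; rewrite fw !linearZ /= fw !linearZ /= fw !scalerA.
      rewrite -subr_eq0 -scalerBl scaler_eq0 (negPf wn0) orbF subr_eq0 => /eqP <-.
      by ring.
    case/negP: w'0; rewrite (cofactor_eigenvalue _ fw) (croot d dn).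
    have -> : c ^+ 2 + c * c + c ^+ 2 = 3%:R * c ^+ 2 by ring.
    by rewrite three0 mul0r scale0r.
  have [d dn dw] := noncyclic_cofactor (ncX _ wX) nfw.
  by case/negP: w'0; rewrite -dw (croot d dn).
have {w'0} w'0 : w' != 0 by [].
clearbody w'; have c3 : c ^+ 2 + c * c + c ^+ 2 != 0.
  have -> : c ^+ 2 + c * c + c ^+ 2 = 3%:R * c ^+ 2 by ring.
  by rewrite mulf_neq0 // expf_neq0.
have nz k : k *: w' = 0 -> k = 0.
  by move=> /eqP; rewrite scaler_eq0 (negPf w'0) orbF => /eqP.
have cw' : cube_cofactor c w' = (c ^+ 2 + c * c + c ^+ 2) *: w'.
  exact: cofactor_eigenvalue fw'.
have uX : v0 + w' \in X by apply: memvD.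
(* If [v0 + w'] had eigenvalue [d], the cofactor of [c], which kills [v0] but not [w'], would give d
   = c, and [v0] would be an eigenvector. *)
have [/vlineP[d fu] | nfu] := boolP (f (v0 + w') \in <[v0 + w']>%VS).
  have := congr1 (cube_cofactor c) fu.
  rewrite -cofactor_comm cofactorZ !cofactorD cv0 !add0r cw' linearZ /= fw' !scalerA.
  move=> /eqP; rewrite -subr_eq0 -scalerBl => /eqP/nz/eqP.
  rewrite [d * _]mulrC -mulrBr mulf_eq0 (negPf c3) /= subr_eq0 => /eqP cd.
  case/negP: fv0; apply/vlineP; exists c; apply: (addIr (f w')).
  by rewrite -linearD /= fu -cd scalerDr fw'.
(* Otherwise the cofactor of some [d] kills [v0 + w']. Applying the cofactor of [c] gives c^2 + d c
   + d^2 = 0. Then the cofactor of [d] kills [v0] too, so d = c as [v0] is no eigenvector, against 3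
   c^2 being nonzero. *)
have [d dn du] := noncyclic_cofactor (ncX _ uX) nfu.
move: du; rewrite cofactorD (cofactor_eigenvalue d fw') => du.
have dv0 : cube_cofactor d v0 = (d - c) *: f v0 + (d ^+ 2 - c ^+ 2) *: v0.
  rewrite -[LHS]subr0 -cv0 /cube_cofactor.
  by vect_ring.
have e0 : (c ^+ 2 + d * c + d ^+ 2) = 0.
  have := congr1 (cube_cofactor c) du.
  rewrite cofactorD cofactorZ cw' dv0 cofactorD !cofactorZ -cofactor_comm cv0.
  rewrite linear0 !scaler0 !add0r scalerA cofactor0.
  by move=> /nz /eqP; rewrite mulf_eq0 (negPf c3) orbF => /eqP.
move: du; rewrite e0 scale0r addr0 dv0 => /eqP; rewrite addr_eq0 => /eqP du.
have dc : d - c = 0.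
  apply/eqP; apply: contraNT fv0 => dc.
  apply/vlineP; exists ((d - c)^-1 * - (d ^+ 2 - c ^+ 2)).
  by rewrite -scalerA scaleNr -du scalerK.
move/eqP: dc; rewrite subr_eq0 => /eqP dc; move: e0; rewrite dc => e0.
by rewrite e0 eqxx in c3.
Qed.

End CubeRoot.

(** * The twisted map t = t(1) tau on L, with tau a field automorphism of order 3 *)

Section Twist.

Variables (F : fieldType) (L : fieldExtType F) (t : 'End(L)).
Hypotheses (dimL : \dim {:L} = 3%N) (t1 : t 1 != 0).
Hypothesis tM : forall a c, t a * t c = t (a * c) * t 1.

Definition tau : 'End(L) := (amulr ((t 1)^-1)%R \o t)%VF.

Lemma tauE a : tau a = t a / t 1.
Proof. by rewrite comp_lfunE lfunE. Qed.

Lemma t_tau a : t a = t 1 * tau a.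
Proof. by rewrite tauE mulrC divfK. Qed.

Lemma tau1 : tau 1 = 1.
Proof. by rewrite tauE divff. Qed.

Lemma tauM a c : tau (a * c) = tau a * tau c.
Proof.
rewrite !tauE mulrACA tM -invfM -mulrA; congr (_ * _).
by rewrite invfM mulrA divff ?mul1r.
Qed.

Lemma t_mul a c : t (a * c) = tau a * t c.
Proof. by rewrite (t_tau (a * c)) (t_tau c) tauM mulrCA. Qed.

Lemma t_iter3 a : t (t (t a)) = tau (tau (tau a)) * t (t (t 1)).
Proof. by rewrite (t_tau a) mulrC !t_mul. Qed.

Hypothesis tau3 : forall a, tau (tau (tau a)) = a.
Hypothesis tau_neq1 : exists a, tau a != a.

Lemma tau_inj : injective tau.
Proof. by move=> a c ac; rewrite -(tau3 a) ac tau3. Qed.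

Lemma tau_eq0 a : (tau a == 0) = (a == 0).
Proof. by rewrite -[X in _ == X](linear0 tau) (inj_eq tau_inj). Qed.

Lemma tauV a : tau a^-1 = (tau a)^-1.
Proof.
have [-> | a0] := eqVneq a 0; first by rewrite invr0 linear0 invr0.
have ta0 : tau a != 0 by rewrite tau_eq0.
by apply: (mulfI ta0); rewrite -tauM !divff ?tau1.
Qed.

(* The fixed field of tau has degree dividing 3 and is not L. *)
Lemma fixed_tau a : tau a = a -> exists k, a = k%:A.
Proof.
have tau_ahom : ahom_in {:L} tau by apply/ahomP_tmp; split; [exact: tau1 | exact: tauM].
pose E : {subfield L} := fixedSpace_aspace (AHom tau_ahom).
have memE c : (c \in E) = (tau c == c) by apply/fixedSpaceP/eqP.
have dimE : (\dim E %| 3)%N by rewrite -dimL field_dimS ?subvf.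
have E3 : \dim E != 3%N.
  apply/eqP=> E3; have [c] := tau_neq1; rewrite -memE => /negP; apply.
  suff -> : (E : {vspace L}) = fullv by rewrite memvf.
  by apply/eqP; rewrite eqEdim subvf dimL E3.
have E1 : (E : {vspace L}) = 1%VS.
  apply/esym/eqP; rewrite eqEdim sub1v dimv1 /=.
  have := dvdn_leq (isT : (0 < 3)%N) dimE.
  by move: dimE E3; case: (\dim E) => [|[|[|[|]]]].
by move=> /eqP; rewrite -memE E1 => /vlineP.
Qed.

(** Dedekind independence of the three powers of [tau], for the leading coefficient only. *)
Lemma tau_independent A B C :
  (forall a, A * tau (tau a) + B * tau a + C * a = 0) -> A = 0.
Proof.
move=> h; have [c tc] := tau_neq1.
have ttc : tau (tau c) != c by apply: contraNneq tc => {1}<-; rewrite tau3.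
(* The relation at [c * a] minus [c] times the relation at [a] eliminates [C]; the same device with
   [tau c], at [a = 1], then eliminates [B]. *)
have h2 a : A * (tau (tau c) - c) * tau (tau a) + B * (tau c - c) * tau a = 0.
  transitivity ((A * tau (tau (c * a)) + B * tau (c * a) + C * (c * a))
     - c * (A * tau (tau a) + B * tau a + C * a)); first by rewrite !tauM; ring.
  by rewrite !h mulr0 subrr.
have h3 : A * (tau (tau c) - c) * (tau (tau c) - tau c) = 0.
  transitivity ((A * (tau (tau c) - c) * tau (tau c) + B * (tau c - c) * tau c)
     - tau c * (A * (tau (tau c) - c) * tau (tau 1) + B * (tau c - c) * tau 1)).
    by rewrite !tau1; ring.
  by rewrite !h2 mulr0 subrr.
move/eqP: h3; rewrite !mulf_eq0 !subr_eq0 (negPf ttc) (inj_eq tau_inj) (negPf tc).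
by rewrite !orbF => /eqP.
Qed.

(** The cube of [t] is multiplication by the norm of [t 1], which is fixed by [tau] and hence lies
    in F. *)
Lemma t_cube : exists2 n, n != 0 & forall a, t (t (t a)) = n *: a.
Proof.
have N a : t (t (t a)) = t 1 * tau (t 1) * tau (tau (t 1)) * a.
  by rewrite (t_tau a) !t_mul (t_tau (tau a)) t_mul (t_tau (tau (tau a))) tau3; ring.
have [n nE] : exists k, t 1 * tau (t 1) * tau (tau (t 1)) = k%:A.
  by apply: fixed_tau; rewrite !tauM tau3; ring.
exists n; last by move=> a; rewrite N nE mulr_algl.
apply/eqP=> n0; move: nE; rewrite n0 scale0r => /eqP.
by rewrite !mulf_eq0 (negPf t1) /= !tau_eq0 (negPf t1).
Qed.

(** Such a relation is a dependence between the powers of [tau] with leading coefficient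
    [t 1 * tau (t 1)], which is nonzero. *)
Lemma t_quadratic_neq0 (c d : F) : ~ forall a, t (t a) + c *: t a + d *: a = 0.
Proof.
move=> h; have := @tau_independent (t 1 * tau (t 1)) (c *: t 1) d%:A.
move=> /(_ _)/eqP; rewrite mulf_eq0 (negPf t1) tau_eq0 (negPf t1).
move=> /(_ _)/negP; apply=> // a; rewrite mulr_algl -[RHS](h a); congr (_ + _ + _).
  by rewrite [t (t a)]t_tau (t_tau a) tauM mulrA.
by rewrite -scalerAl -t_tau.
Qed.

Lemma t_not_scalar (c : F) : ~ forall a, t a = c *: a.
Proof.
move=> h; apply: (@t_quadratic_neq0 0 (- c ^+ 2)) => a.
by rewrite !h scale0r addr0 scalerA -scalerDl expr2 subrr scale0r.
Qed.

Lemma cofactor_t_neq0 c : exists a, cube_cofactor t c a != 0.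
Proof.
have [g0 | /lfunPn[a]] := eqVneq (t \o t + c *: t + c ^+ 2 *: \1)%VF 0.
  case: (@t_quadratic_neq0 c (c ^+ 2)) => a.
  by rewrite -/(cube_cofactor t c a) cofactor_lfunE g0 zero_lfunE.
by rewrite -cofactor_lfunE zero_lfunE => ?; exists a.
Qed.

Variable n : F.
Hypothesis t3 : forall a, t (t (t a)) = n *: a.

(** Any nonzero value [a0] of the cofactor is an eigenvector, and the quotient of two eigenvectors
    for [c] is fixed by [tau], hence lies in F. *)
Lemma t_eigen c : c ^+ 3 = n ->
  exists2 a0, a0 != 0 & forall a, t a = c *: a <-> exists k, a = k *: a0.
Proof.
move=> cn; have [a1 a10] := cofactor_t_neq0 c.
have ta0 := cofactor_eigen t3 a1 cn; set a0 := cube_cofactor t c a1 in a10 ta0.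
exists a0 => // a; split=> [ta | [k ->]]; last first.
  by rewrite linearZ /= ta0 !scalerA mulrC.
have c0 : c != 0.
  apply: contraNneq a10 => c0; move: ta0; rewrite c0 scale0r t_tau => /eqP.
  by rewrite mulf_eq0 (negPf t1) tau_eq0.
have [k kE] : exists k, a / a0 = k%:A.
  apply: fixed_tau; rewrite tauM tauV.
  have cA : c%:A != 0 :> L by rewrite scaler_eq0 oner_eq0 orbF.
  rewrite !tauE ta ta0 -(mulr_algl c a) -(mulr_algl c a0) invfM invrK invfM.
  by rewrite mulrACA mulVf // mulr1 mulrACA divff // mul1r.
by exists k; rewrite -mulr_algl -kE divfK.
Qed.

(** The image of t - c has dimension 3 - 1 = 2 and lies in the kernel of the cofactor, which is not
    all of L; so the two coincide. *)
Lemma t_cofactor_image c a : c ^+ 3 = n -> cube_cofactor t c a = 0 ->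
  exists y, a = t y - c *: y.
Proof.
move=> cn ca; have [a0 a00 ta0] := t_eigen cn.
pose g := t - c *: \1%VF; have gE y : g y = t y - c *: y.
  by rewrite add_lfunE opp_lfunE scale_lfunE id_lfunE.
have kerg : lker g = <[a0]>%VS.
  apply/vspaceP=> y; rewrite memv_ker gE subr_eq0.
  by apply/eqP/vlineP => [/ta0 | /ta0].
have dimg : \dim (limg g) = 2%N.
  have := limg_ker_dim g fullv; rewrite capfv kerg dim_vline a00 dimL.
  by rewrite add1n => -[].
pose p := (t \o t + c *: t + c ^+ 2 *: \1)%VF.
have gp : (limg g <= lker p)%VS.
  apply/subvP=> _ /memv_imgP[y _ ->].
  by rewrite memv_ker -cofactor_lfunE gE (cofactor_sub t3).
have /eqP gpE : limg g == lker p.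
  rewrite eqEdim gp dimg leqNgt; apply/negP=> dimp.
  have [y /negP[]] := cofactor_t_neq0 c; rewrite cofactor_lfunE -memv_ker -/p.
  suff -> : lker p = fullv by rewrite memvf.
  by apply/eqP; rewrite eqEdim subvf dimL.
have : a \in limg g by rewrite gpE memv_ker -cofactor_lfunE ca.
by case/memv_imgP=> y _ ->; exists y.
Qed.

End Twist.

(** * Row vectors and the points that they span *)

Lemma vline_coord (K : fieldType) m (u w : 'rV[K]_m) : u \in <[w]>%VS ->
  exists k, forall h, u 0 h = k * w 0 h.
Proof. by case/vlineP=> k ->; exists k => h; rewrite mxE. Qed.

Lemma comb_coord (K : fieldType) d (k m : K) (u w : 'rV[K]_d) h :
  (k *: u + m *: w) 0 h = k * u 0 h + m * w 0 h.
Proof. by rewrite !mxE. Qed.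

Lemma row_neq0 (K : fieldType) m (x : 'rV[K]_m) : x != 0 -> exists i, x 0 i != 0.
Proof.
move=> x0; apply/existsP; apply: contraNT x0 => /existsPn x0.
by apply/eqP/rowP=> i; rewrite mxE; apply/eqP; have := x0 i; rewrite negbK.
Qed.

Section Points.

Variables (K : fieldType) (n : nat).

Lemma vlineZ (k : K) (u : 'rV[K]_n) : k != 0 -> (<[k *: u]> = <[u]>)%VS.
Proof.
move=> k0; apply/eqP; rewrite eqEsubv -!memvE memvZ ?memv_line //=.
by apply/vlineP; exists k^-1; rewrite scalerK.
Qed.

Lemma default_point_subproof : \dim <[(const_mx 1 : 'rV[K]_n.+1)%R]>%VS == 1%N.
Proof.
rewrite dim_vline eqb1; apply/eqP=> /rowP/(_ 0)/eqP.
by rewrite !mxE oner_eq0.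
Qed.

Definition default_point : pg_point K n :=
  exist (fun P : {vspace 'rV[K]_n.+1} => \dim P == 1%N) _ default_point_subproof.

(* The point spanned by u; a junk point if u = 0. *)
Definition point_of (u : 'rV[K]_n.+1) : pg_point K n :=
  insubd default_point <[u]>%VS.

Lemma val_point_of u : u != 0 -> val (point_of u) = <[u]>%VS.
Proof. by move=> u0; rewrite insubdK // unfold_in dim_vline u0. Qed.

Lemma pointP (P : pg_point K n) : exists2 u, u != 0 & val P = <[u]>%VS.
Proof.
have w0 : vpick (val P) != 0.
  by rewrite vpick0; apply: contraTneq (valP P) => ->; rewrite dimv0.
exists (vpick (val P)) => //; apply/esym/eqP.
by rewrite eqEdim -memvE memv_pick (eqP (valP P)) dim_vline w0.
Qed.

Lemma point_eq_vline (P : pg_point K n) u : u != 0 -> u \in val P ->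
  val P = <[u]>%VS.
Proof.
move=> u0 uP; apply/esym/eqP.
by rewrite eqEdim -memvE uP (eqP (valP P)) dim_vline u0.
Qed.

End Points.

(** * The Bose representation in the coordinates given by the rows of [b] *)

Section Coordinates.

Variables (F : finFieldType) (L : fieldExtType F) (e : 3.-tuple L) (b : 'M[L]_3).
Hypotheses (e_basis : basis_of {:L} e) (b_unit : b \in unitmx).

Definition unbose (v : 'rV[F]_9) : 'rV[L]_3 :=
  \row_i \sum_j (@vec_mx F 3 3 v) i j *: e`_j.

Lemma boseK : cancel (bose e) unbose.
Proof.
move=> u; apply/rowP=> i; rewrite mxE /bose mxvecK.
rewrite [RHS](coord_basis e_basis (memvf _)).
by apply: eq_bigr => j _; rewrite mxE.
Qed.

Lemma unboseK : cancel unbose (bose e).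
Proof.
move=> v; rewrite /bose -[RHS](@vec_mxK F 3 3); congr (@mxvec F 3 3 _).
apply/matrixP=> i j; rewrite mxE [unbose v 0 i]mxE.
by rewrite coord_sum_free ?(basis_free e_basis).
Qed.

Lemma boseD u v : bose e (u + v) = bose e u + bose e v.
Proof. by have := bose_linear e 1 u v; rewrite !scale1r. Qed.

Lemma bose0 : bose e 0 = 0.
Proof. by apply: (addIr (bose e 0)); rewrite -boseD !add0r. Qed.

Lemma boseZ k u : bose e (k%:A *: u) = k *: bose e u.
Proof. by have := bose_linear e k u 0; rewrite bose0 !addr0. Qed.

Lemma unboseD u v : unbose (u + v) = unbose u + unbose v.
Proof. by apply: (can_inj boseK); rewrite boseD !unboseK. Qed.

Lemma unboseZ k u : unbose (k *: u) = k%:A *: unbose u.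
Proof. by apply: (can_inj boseK); rewrite boseZ !unboseK. Qed.

Lemma unbose0 : unbose 0 = 0.
Proof. by rewrite -bose0 boseK. Qed.

(** The selected vectors already form a subspace; taking the span of their finite list packages them
    as a [vspace]. *)
Definition bose_space (U : {vspace 'rV[L]_3}) : {vspace 'rV[F]_9} :=
  <<[seq v <- enum 'rV[F]_9 | unbose v \in U]>>%VS.

Lemma mem_bose_space U v : (v \in bose_space U) = (unbose v \in U).
Proof.
apply/idP/idP=> [vU | vU]; last first.
  by apply: memv_span; rewrite mem_filter vU mem_enum.
rewrite (coord_span (X := in_tuple _) vU).
apply: (big_ind (fun w => unbose w \in U)) => [|u w uU wU|i _].
- by rewrite unbose0 mem0v.
- by rewrite unboseD memvD.
rewrite unboseZ memvZ //; set s := filter _ _ in i *.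
by have := mem_nth 0 (ltn_ord i : (i < size s)%N); rewrite mem_filter => /andP[].
Qed.

Lemma mem_bose_planeE P v : (v \in bose_plane e P) = (unbose v \in val P).
Proof.
apply/idP/idP=> [/(mem_bose_plane _ _ e_basis)[u uP ->] | vP].
  by rewrite boseK.
by apply/(mem_bose_plane _ _ e_basis); exists (unbose v); rewrite ?unboseK.
Qed.

(** Each nonzero vector of [l] spans a point of [l], so a subspace containing the planes of all
    these points contains [bose_space l]. *)
Lemma bose_lineP l Pi : bose_line e l Pi <-> Pi = bose_space l.
Proof.
have up P : (val P <= l)%VS -> (bose_plane e P <= bose_space l)%VS.
  move=> Pl; apply/subvP=> v; rewrite mem_bose_planeE mem_bose_space.
  exact: subvP.
have min (S : {vspace 'rV[F]_9}) :
    (forall P, (val P <= l)%VS -> (bose_plane e P <= S)%VS) -> (bose_space l <= S)%VS.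
  move=> lS; apply/subvP=> v; rewrite mem_bose_space => vl.
  have [u0 | u0] := eqVneq (unbose v) 0.
    by rewrite -(unboseK v) u0 bose0 mem0v.
  have vE := val_point_of u0.
  apply: (subvP (lS (point_of (unbose v)) _)); first by rewrite vE -memvE.
  by rewrite mem_bose_planeE vE memv_line.
split=> [[upPi minPi] | ->] //.
by apply: subv_anti; rewrite min // minPi.
Qed.

(** Here [x] is a coordinate row relative to the rows of [b]; the points of the subplane are those
    with a coordinate row over F. *)
Definition psi (x : 'rV[L]_3) : 'rV[F]_9 := bose e (x *m b).
Definition unpsi (v : 'rV[F]_9) : 'rV[L]_3 := unbose v *m invmx b.

Lemma psiK : cancel psi unpsi.
Proof. by move=> x; rewrite /unpsi boseK mulmxK. Qed.

Lemma unpsiK : cancel unpsi psi.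
Proof. by move=> v; rewrite /psi mulmxKV ?unboseK. Qed.

Lemma psi_inj : injective psi. Proof. exact: can_inj psiK. Qed.

Lemma psiD x y : psi (x + y) = psi x + psi y.
Proof. by rewrite /psi mulmxDl boseD. Qed.

Lemma psiZ k x : psi (k%:A *: x) = k *: psi x.
Proof. by rewrite /psi -scalemxAl boseZ. Qed.

Lemma psi0 : psi 0 = 0.
Proof. by rewrite /psi mul0mx bose0. Qed.

Lemma psi_eq0 x : (psi x == 0) = (x == 0).
Proof. by rewrite -[X in _ == X]psi0 (inj_eq psi_inj). Qed.

Lemma psi_sum (I : finType) (f : I -> 'rV[L]_3) :
  psi (\sum_i f i) = \sum_i psi (f i).
Proof. exact: (big_morph psi psiD psi0). Qed.

Lemma mulmx_b_inj : injective (fun x : 'rV[L]_3 => x *m b).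
Proof. exact: can_inj (mulmxK b_unit). Qed.

Lemma mulmx_b_eq0 (x : 'rV[L]_3) : (x *m b == 0) = (x == 0).
Proof. by rewrite -(inj_eq mulmx_b_inj) mul0mx. Qed.

Lemma coord_pointP (P : pg_point L 2) :
  exists2 x, x != 0 & val P = <[x *m b]>%VS.
Proof.
have [u u0 ->] := pointP P; exists (u *m invmx b); last by rewrite mulmxKV.
by rewrite -mulmx_b_eq0 mulmxKV.
Qed.

Lemma mem_vline_b (x y : 'rV[L]_3) :
  (x *m b \in <[y *m b]>%VS) = (x \in <[y]>%VS).
Proof.
apply/vlineP/vlineP=> [[k xy] | [k ->]]; exists k; last by rewrite scalemxAl.
by apply: mulmx_b_inj; rewrite xy scalemxAl.
Qed.

Lemma mem_bose_plane_psi P x : (psi x \in bose_plane e P) = (x *m b \in val P).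
Proof. by rewrite mem_bose_planeE boseK. Qed.

Definition ratl (c : 'rV[F]_3) : 'rV[L]_3 := map_mx (in_alg L) c.

Lemma ratl_eq0 c : (ratl c == 0) = (c == 0).
Proof. exact: map_mx_eq0. Qed.

Lemma ratl_delta i : ratl (delta_mx 0 i) = delta_mx 0 i.
Proof. exact: map_delta_mx. Qed.

Variable (phi : pg_point L 2 -> pg_point L 2) (sigma : 'End('rV[F]_9)).
Hypothesis phi_fix : forall P, subplane b P -> phi P = P.
Hypothesis sigma_inj : lker sigma = 0%VS.
Hypothesis sigma_phi :
  forall P, (sigma @: bose_plane e P)%VS = bose_plane e (phi P).

Lemma sigma_eq0 v : (sigma v == 0) = (v == 0).
Proof. by rewrite -memv_ker sigma_inj memv0. Qed.

(** The point with coordinates [ratl c] is in the subplane, so [phi] fixes it and [sigma] preserves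
    its plane. *)
Lemma sigma_ratl c a : c != 0 -> exists d, sigma (psi (a *: ratl c)) = psi (d *: ratl c).
Proof.
move=> c0; have u0 : ratl c *m b != 0 by rewrite mulmx_b_eq0 ratl_eq0.
pose P := point_of (ratl c *m b); have PE := val_point_of u0; rewrite -/P in PE.
have PI : subplane b P by apply/existsP; exists c; rewrite PE.
have : sigma (psi (a *: ratl c)) \in bose_plane e P.
  rewrite -{1}(phi_fix PI) -sigma_phi memv_img // mem_bose_plane_psi PE.
  by rewrite -scalemxAl memvZ ?memv_line.
rewrite -[sigma _]unpsiK mem_bose_plane_psi PE mem_vline_b => /vlineP[d ->].
by exists d.
Qed.

(* All coordinates are transformed by the same map, because the points of the
   frame given by the rows of b and their sum are fixed. *)
Lemma sigma_coordinates :
  exists t : 'End(L), forall x, sigma (psi x) = psi (map_mx t x).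
Proof.
(* The common map, read off in the first coordinate. *)
pose t0 a := unpsi (sigma (psi (a *: delta_mx 0 0))) 0 0.
have sum1 a : a *: ratl (const_mx 1) = \sum_i a *: delta_mx 0 i.
  apply/rowP=> j; rewrite summxE !mxE rmorph1 mulr1 (bigD1 j) //= !mxE !eqxx mulr1.
  by rewrite big1 ?addr0 // => i ij; rewrite !mxE eq_sym (negPf ij) andbF mulr0.
have t0P a i : sigma (psi (a *: delta_mx 0 i)) = psi (t0 a *: delta_mx 0 i).
  have del j : exists d, sigma (psi (a *: delta_mx 0 j)) = psi (d *: delta_mx 0 j).
    have : (delta_mx 0 j : 'rV[F]_3) != 0.
      by apply/eqP=> /rowP/(_ j)/eqP; rewrite !mxE !eqxx oner_eq0.
    by move=> /(@sigma_ratl _ a)[d]; rewrite ratl_delta; exists d.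
  have [d dE] := fin_all_exists del.
  have c0 : (const_mx 1 : 'rV[F]_3) != 0.
    by apply/eqP=> /rowP/(_ 0)/eqP; rewrite !mxE oner_eq0.
  have [d0] := @sigma_ratl _ a c0; rewrite !sum1 !psi_sum linear_sum /=.
  rewrite (eq_bigr _ (fun i _ => dE i)) -!psi_sum => /psi_inj dd.
  have dd0 j : d j = d0.
    have /rowP/(_ j) := dd; rewrite -sum1 !summxE (bigD1 j) //=.
    rewrite !mxE !eqxx !mulr1 rmorph1 mulr1.
    by rewrite big1 ?addr0 // => k kj; rewrite !mxE eq_sym (negPf kj) andbF mulr0.
  by rewrite dE /t0 dE psiK !mxE !eqxx mulr1 !dd0.
have t0lin : linear t0.
  move=> k a c; rewrite /t0 scalerDl psiD linearD /= -mulr_algl -scalerA psiZ linearZ /=.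
  set u := sigma _; set v := sigma _.
  by rewrite /unpsi unboseD unboseZ mulmxDl -scalemxAl !mxE mulr_algl.
pose tl : {linear L -> L} := HB.pack t0 (GRing.isLinear.Build F L L _ t0 t0lin).
exists (linfun tl) => x; rewrite {1}(row_sum_delta x).
rewrite psi_sum linear_sum /= (eq_bigr _ (fun i _ => t0P _ i)) -psi_sum.
congr psi; rewrite [RHS]row_sum_delta; apply: eq_bigr => i _.
by congr (_ *: _); rewrite [RHS]mxE (lfunE tl).
Qed.

End Coordinates.

(** * The collineation [phi] in coordinates, and the automorphism that it induces *)

Section Semilinear.

Variables (F : finFieldType) (L : fieldExtType F) (e : 3.-tuple L) (b : 'M[L]_3).
Hypotheses (e_basis : basis_of {:L} e) (b_unit : b \in unitmx).
Variables (phi : pg_point L 2 -> pg_point L 2) (sigma : 'End('rV[F]_9)).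
Hypothesis phi_order : has_order phi 3.
Hypothesis sigma_inj : lker sigma = 0%VS.
Hypothesis sigma_phi :
  forall P, (sigma @: bose_plane e P)%VS = bose_plane e (phi P).
Variable t : 'End(L).
Hypothesis sigma_t : forall x, sigma (psi e b x) = psi e b (map_mx t x).

Lemma map_t_eq0 x : (map_mx t x == 0 :> 'rV[L]_3) = (x == 0).
Proof.
by rewrite -(psi_eq0 e_basis b_unit) -sigma_t (sigma_eq0 sigma_inj) psi_eq0.
Qed.

Lemma phi_coord P x : x != 0 -> val P = <[x *m b]>%VS ->
  val (phi P) = <[map_mx t x *m b]>%VS.
Proof.
move=> x0 PE; apply: point_eq_vline; first by rewrite mulmx_b_eq0 // map_t_eq0.
rewrite -(mem_bose_plane_psi b e_basis) -sigma_t -sigma_phi memv_img //.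
by rewrite mem_bose_plane_psi // PE memv_line.
Qed.

(** When images of such rows are proportional, the first coordinate gives the factor and the second
    a relation for [t a]. *)
Let test_row (a : L) : 'rV[L]_3 := \row_j [:: 1; a; 0]`_j.

Let test_row_neq0 a : test_row a != 0.
Proof. by apply/eqP=> /rowP/(_ 0)/eqP; rewrite !mxE oner_eq0. Qed.

Lemma t1_neq0 : t 1 != 0.
Proof.
pose x : 'rV[L]_3 := delta_mx 0 0.
have : map_mx t x != 0.
  rewrite map_t_eq0; apply/eqP=> /rowP/(_ 0)/eqP; by rewrite !mxE oner_eq0.
apply: contraNneq => t10; apply/eqP/rowP=> j; rewrite !mxE.
by case: (j == 0); rewrite /= ?mulr1n ?mulr0n ?linear0.
Qed.

Lemma val_coord_point x : x != 0 -> val (point_of (x *m b)) = <[x *m b]>%VS.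
Proof. by move=> x0; rewrite val_point_of // mulmx_b_eq0. Qed.

(** The rows x = (1, c, 0) and a x span the same point, so their images are proportional: t(a) = k
    t(1) and t(a c) = k t(c). *)
Lemma t_multiplicative a c : t a * t c = t (a * c) * t 1.
Proof.
have [-> | a0] := eqVneq a 0; first by rewrite mul0r linear0 !mul0r.
set x := test_row c; have x0 : x != 0 := test_row_neq0 c.
have ax0 : a *: x != 0 by rewrite scaler_eq0 negb_or a0.
have PE := val_coord_point x0; have Pa := PE; rewrite -(vlineZ _ a0) scalemxAl in Pa.
have := phi_coord ax0 Pa; rewrite (phi_coord x0 PE) => /esym tax.
have : map_mx t (a *: x) \in <[map_mx t x]>%VS.
  by rewrite -(mem_vline_b b_unit) -tax memv_line.
case/vlineP=> k /rowP kE; have := kE 0; have := kE 1; rewrite !mxE /= mulr1 => -> ->.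
by ring.
Qed.

(** If [tau] were the identity, [t] would be multiplication by [t 1] and [phi] would fix every
    point, against its order 3. *)
Lemma tau_neq_id : exists a, tau t a != a.
Proof.
have [t_id | /lfunPn[a]] := eqVneq (tau t) \1%VF; last first.
  by rewrite id_lfunE; exists a.
have [_ _ /(_ 1%N isT)] := phi_order; case=> P /=; apply: val_inj.
have [x x0 PE] := coord_pointP b_unit P; rewrite (phi_coord x0 PE) PE.
have -> : map_mx t x = t 1 *: x.
  by apply/rowP=> i; rewrite !mxE (t_tau t1_neq0) t_id id_lfunE.
by rewrite -scalemxAl vlineZ ?t1_neq0.
Qed.

(** As [phi] has order 3, the third iterate of [map_mx t] multiplies (1, a, 0) by some nonzero [k];
    its first coordinate shows that [k] is the third iterate of [t] at 1, and the second that [k]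
    cancels. *)
Lemma tau_cubed a : tau t (tau t (tau t a)) = a.
Proof.
have t1 := t1_neq0; have tM := t_multiplicative.
set x := test_row a; have x0 : x != 0 := test_row_neq0 a.
have PE := val_coord_point x0.
have tx0 : map_mx t x != 0 by rewrite map_t_eq0.
have ttx0 : map_mx t (map_mx t x) != 0 by rewrite map_t_eq0.
have := phi_coord ttx0 (phi_coord tx0 (phi_coord x0 PE)).
have [_ /(_ (point_of (x *m b))) /= -> _] := phi_order; rewrite PE => tttE.
have : map_mx t (map_mx t (map_mx t x)) \in <[x]>%VS.
  by rewrite -(mem_vline_b b_unit) tttE memv_line.
case/vlineP=> k /rowP kE; have := kE 0; have := kE 1; rewrite !mxE /= mulr1.
rewrite (t_iter3 t1 tM) => + tttk; rewrite -tttk mulrC; apply: mulfI.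
rewrite tttk; apply: contraNneq x0 => k0; rewrite -map_t_eq0 -map_t_eq0 -map_t_eq0.
by apply/eqP/rowP=> j; rewrite kE k0 !mxE mul0r.
Qed.

End Semilinear.

(** * Eigenspaces of [sigma], hwise-fixed 5-spaces and cyclic vectors of planes of subplane
    points *)

Section FixedSubspaces.

Variables (F : finFieldType) (L : fieldExtType F) (e : 3.-tuple L) (b : 'M[L]_3).
Hypotheses (dimL : \dim {:L} = 3%N) (e_basis : basis_of {:L} e).
Hypothesis b_unit : b \in unitmx.
Variables (sigma : 'End('rV[F]_9)) (t : 'End(L)).
Hypothesis sigma_t : forall x, sigma (psi e b x) = psi e b (map_mx t x).
Hypotheses (sigma_inj : lker sigma = 0%VS) (t1 : t 1 != 0).
Hypothesis tM : forall a c, t a * t c = t (a * c) * t 1.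
Hypothesis tau3 : forall a, tau t (tau t (tau t a)) = a.
Hypothesis tau_neq1 : exists a, tau t a != a.
Variable n : F.
Hypotheses (n0 : n != 0) (t3 : forall a, t (t (t a)) = n *: a).

Notation psi := (psi e b).
Notation unpsi := (unpsi e b).
Notation ratl := (@ratl F L).

Lemma sigma_cubed v : sigma (sigma (sigma v)) = n *: v.
Proof.
rewrite -(unpsiK e_basis b_unit v) !sigma_t -psiZ; congr (Defs.bose e (_ *m b)).
by apply/rowP=> i; rewrite !mxE t3 mulr_algl.
Qed.

Lemma sigma_subE c v : (sigma - c *: \1)%VF v = sigma v - c *: v.
Proof. by rewrite add_lfunE opp_lfunE scale_lfunE id_lfunE. Qed.

Lemma cofactor_psi c x :
  cube_cofactor sigma c (psi x) = psi (\row_i cube_cofactor t c (x 0 i)).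
Proof.
rewrite /cube_cofactor !sigma_t -!psiZ -!psiD; congr (Defs.bose e (_ *m b)).
by apply/rowP=> i; rewrite !mxE !mulr_algl.
Qed.

Lemma map_t_ratl a c : map_mx t (a *: ratl c) = t a *: ratl c.
Proof.
by apply/rowP=> i; rewrite !mxE /= !(mulrC _ (_ *: 1)) !mulr_algl linearZ.
Qed.

(** Each of the three coordinates of an eigenvector runs independently through the F-line spanned by
    [a0], the eigenspace of [t]. *)
Lemma dim_eigenspace c : c ^+ 3 = n -> \dim (lker (sigma - c *: \1)%VF) = 3%N.
Proof.
move=> cn; have [a0 a00 a0P] := t_eigen dimL t1 tM tau3 tau_neq1 t3 cn.
pose s := [tuple psi (a0 *: delta_mx 0 i) | i < 3].
have comb (k : 'I_3 -> F) : \sum_i k i *: s`_i = psi (\row_i (k i *: a0)).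
  rewrite [X in psi X]row_sum_delta psi_sum; apply: eq_bigr => i _.
  by rewrite -tnth_nth tnth_mktuple -psiZ !mxE scalerA mulr_algl.
have -> : lker (sigma - c *: \1)%VF = <<s>>%VS.
  apply/eqP; rewrite eqEsubv; apply/andP; split; apply/subvP=> v.
    rewrite memv_ker sigma_subE subr_eq0 -(unpsiK e_basis b_unit v) sigma_t -psiZ.
    move: (unpsi v) => x /eqP/(psi_inj e_basis b_unit)/rowP tx.
    have /fin_all_exists[k kE] i : exists k, x 0 i = k *: a0.
      by apply/a0P; have := tx i; rewrite !mxE mulr_algl.
    have -> : x = \row_i (k i *: a0) by apply/rowP=> i; rewrite mxE kE.
    rewrite -comb; apply: memv_suml => i _; apply: memvZ; apply: memv_span.
    by rewrite mem_nth ?size_tuple.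
  move=> /coord_span ->; rewrite comb memv_ker sigma_subE subr_eq0 sigma_t -psiZ.
  apply/eqP; congr (Defs.bose e (_ *m b)); apply/rowP=> i; rewrite !mxE mulr_algl.
  by apply/a0P; eexists.
suff /eqP -> : free s by rewrite size_tuple.
apply/freeP=> k; rewrite comb => /eqP; rewrite psi_eq0 // => /eqP/rowP k0 i.
by have /eqP := k0 i; rewrite !mxE scaler_eq0 (negPf a00) orbF => /eqP.
Qed.

Lemma dim_image c : c ^+ 3 = n -> \dim (limg (sigma - c *: \1)%VF) = 6%N.
Proof.
move=> cn; have := limg_ker_dim (sigma - c *: \1)%VF fullv.
by rewrite capfv dim_eigenspace // dimvf dim_matrix => -[].
Qed.

Lemma cofactor_image c v : c ^+ 3 = n -> cube_cofactor sigma c v = 0 ->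
  v \in limg (sigma - c *: \1)%VF.
Proof.
move=> cn; rewrite -(unpsiK e_basis b_unit v) cofactor_psi.
move: (unpsi v) => x /eqP; rewrite psi_eq0 // => /eqP/rowP x0.
have /fin_all_exists[y yE] i : exists y, x 0 i = t y - c *: y.
  by apply: (t_cofactor_image dimL t1 tM tau3 tau_neq1 t3 cn); have := x0 i; rewrite !mxE.
apply/memv_imgP; exists (psi (\row_i y i)); rewrite ?memvf // sigma_subE.
rewrite sigma_t -psiZ -scaleN1r -psiZ -psiD; congr (Defs.bose e (_ *m b)).
by apply/rowP=> i; rewrite !mxE yE scaleN1r mulN1r mulr_algl.
Qed.

(** Since sigma v = (sigma - c) v + c v, every subspace containing the image of sigma - c is
    preserved. *)
Lemma hwise_image c : c ^+ 3 = n ->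
  hwise_fixed_5space sigma (limg (sigma - c *: \1)%VF).
Proof.
move=> cn; split=> [|S dimS sub]; first exact: dim_image.
apply/eqP; rewrite eqEdim limg_dim_eq ?sigma_inj ?capv0 // leqnn andbT.
apply/subvP=> _ /memv_imgP[v vS ->]; rewrite -(subrK (c *: v) (sigma v)) -sigma_subE.
by rewrite memvD ?memvZ // (subvP sub) // memv_img ?memvf.
Qed.

(** As [Pi] has codimension 3, it is the intersection of two fixed subspaces [Pi + <[u1]>] and [Pi +
    <[u2]>]. *)
Lemma hwise_stable Pi : hwise_fixed_5space sigma Pi ->
  {in Pi, forall v, sigma v \in Pi}.
Proof.
move=> [dimPi fixPi] v vPi.
have bigger (S : {vspace 'rV[F]_9}) : (\dim S < 9)%N -> exists u, u \notin S.
  move=> dimS; have /subvPn[u _ uS] : ~~ (fullv <= S)%VS.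
    by apply/negP=> /dimvS; rewrite dimvf dim_matrix leqNgt dimS.
  by exists u.
have dim7 u : u \notin Pi -> \dim (Pi + <[u]>)%VS = 7%N.
  by move=> uPi; rewrite dim_addv_line ?dimPi.
have img u : u \notin Pi -> sigma v \in (Pi + <[u]>)%VS.
  move=> uPi; rewrite -(fixPi _ (dim7 u uPi)) ?addvSl // memv_img //.
  by rewrite (subvP (addvSl _ _)).
have [|u1 u1Pi] := bigger Pi; first by rewrite dimPi.
have [|u2 u2Pi] := bigger (Pi + <[u1]>)%VS; first by rewrite dim7.
have u2P : u2 \notin Pi by apply: contra u2Pi; apply/subvP/addvSl.
have /memv_addP[p pPi [_ /vlineP[k ->] vE]] := img _ u2P.
have [k0 | k0] := eqVneq k 0; first by rewrite vE k0 scale0r addr0.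
case/negP: u2Pi; rewrite -(scalerK k0 u2) memvZ //.
have -> : k *: u2 = sigma v - p by rewrite vE addrC addKr.
by rewrite memvB ?img // (subvP (addvSl _ _)).
Qed.

(** All subspaces [Pi + <[v]>] are fixed, so [sigma] is a scalar [c] modulo [Pi] and the image of
    sigma - c lies in [Pi]. Hence the kernel is nonzero, an eigenvector in it gives c^3 = n, and the
    dimensions agree. *)
Lemma hwise_is_image Pi : hwise_fixed_5space sigma Pi ->
  exists2 c, c ^+ 3 = n & Pi = limg (sigma - c *: \1)%VF.
Proof.
move=> hPi; have [dimPi fixPi] := hPi.
have [|c cP] := scalar_modulo (hwise_stable hPi) (X := fullv).
  move=> v _; have [vPi | vPi] := boolP (v \in Pi).
    by rewrite (subvP (addvSl _ _)) // hwise_stable.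
  suff <- : (sigma @: (Pi + <[v]>))%VS = (Pi + <[v]>)%VS.
    by rewrite memv_img // (subvP (addvSr _ _)) ?memv_line.
  apply: fixPi; rewrite ?addvSl //.
  by rewrite dim_addv_line ?dimPi.
have sub : (limg (sigma - c *: \1)%VF <= Pi)%VS.
  by apply/subvP=> _ /memv_imgP[v vS ->]; rewrite sigma_subE cP.
have cn : c ^+ 3 = n.
  have kerN0 : lker (sigma - c *: \1)%VF != 0%VS.
    have := limg_ker_dim (sigma - c *: \1)%VF fullv.
    rewrite capfv dimvf dim_matrix => dims; apply/eqP=> ker0.
    by move: dims (dimvS sub); rewrite ker0 dimv0 add0n dimPi => ->.
  have := memv_pick (lker (sigma - c *: \1)%VF); move: kerN0; rewrite -vpick0.
  set w := vpick _ => w0; rewrite memv_ker sigma_subE subr_eq0 => /eqP sw.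
  have /eqP := sigma_cubed w; rewrite sw !linearZ /= sw !linearZ /= sw !scalerA.
  rewrite -subr_eq0 -scalerBl scaler_eq0 (negPf w0) orbF subr_eq0 => /eqP <-.
  by ring.
by exists c => //; apply/esym/eqP; rewrite eqEdim sub dimPi dim_image.
Qed.

(** On the plane of a subplane point [sigma] acts as [t] does on L. Without a cyclic vector it would
    be a scalar or be killed by a cofactor, and [t] is neither. *)
Lemma SI_plane_cyclic P : subplane b P ->
  exists2 v, v \in bose_plane e P & cyclic_vector sigma v.
Proof.
case/existsP=> c /eqP PE.
have c0 : ratl c != 0.
  by apply: contraTneq (valP P) => c0; rewrite PE -/(ratl c) c0 mul0mx dim_vline eqxx.
have memP a : psi (a *: ratl c) \in bose_plane e P.
  by rewrite mem_bose_plane_psi // PE -scalemxAl memvZ ?memv_line.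
have memPE v : v \in bose_plane e P -> exists a, v = psi (a *: ratl c).
  rewrite -(unpsiK e_basis b_unit v) mem_bose_plane_psi // PE mem_vline_b //.
  by case/vlineP=> a ->; exists a.
have stable : {in bose_plane e P, forall v, sigma v \in bose_plane e P}.
  by move=> v /memPE[a ->]; rewrite sigma_t map_t_ratl.
have [/existsP[v /andP[vP cv]] | /existsPn nc] :=
  boolP [exists v, (v \in bose_plane e P) && cyclic_vector sigma v]; first by exists v.
have {}nc : {in bose_plane e P, forall v, ~~ cyclic_vector sigma v}.
  by move=> v vP; have := nc v; rewrite vP.
exfalso.
have [/forallP eig | /forallPn[v0]] :=
  boolP [forall v, (v \in bose_plane e P) ==> (sigma v \in <[v]>%VS)].
  have [||d dP] := @scalar_modulo _ _ sigma 0%VS (bose_plane e P).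
  - by move=> v; rewrite !memv0 => /eqP ->; rewrite linear0.
  - by move=> v vP; rewrite add0v; have := eig v; rewrite vP.
  apply: (t_not_scalar t1 tM tau3 tau_neq1 (c := d)) => a.
  have := dP _ (memP a); rewrite memv0 subr_eq0 sigma_t map_t_ratl -psiZ scalerA.
  move=> /eqP/(psi_inj e_basis b_unit)/eqP; rewrite -subr_eq0 -scalerBl scaler_eq0.
  by rewrite (negPf c0) orbF subr_eq0 mulr_algl => /eqP.
rewrite negb_imply => /andP[v0P v0N].
have [d dn dP] := noncyclic_space sigma_cubed n0 stable nc v0P v0N.
have [a /eqP[]] := cofactor_t_neq0 t1 tM tau3 tau_neq1 d.
have := dP _ (memP a); rewrite /cube_cofactor !(sigma_t, map_t_ratl) -!psiZ -!psiD.
move=> /eqP; rewrite psi_eq0 // !scalerA -!scalerDl scaler_eq0 (negPf c0) orbF.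
by rewrite !mulr_algl => /eqP.
Qed.

End FixedSubspaces.

(** * Lines of the plane over L that come from the subplane *)

Section RationalLines.

Variables (F : finFieldType) (L : fieldExtType F) (b : 'M[L]_3).
Hypothesis b_unit : b \in unitmx.

Notation ratl := (@ratl F L).

Lemma mem_add_lines_b (u x y : 'rV[L]_3) :
  (u *m b \in <[x *m b]> + <[y *m b]>)%VS = (u \in <[x]> + <[y]>)%VS.
Proof.
apply/memv_add_lines/memv_add_lines=> -[k [m uE]]; exists k, m.
  by apply: (mulmx_b_inj b_unit); rewrite uE mulmxDl !scalemxAl.
by rewrite uE mulmxDl !scalemxAl.
Qed.

Lemma ratlE c i : ratl c 0 i = (c 0 i)%:A.
Proof. by rewrite mxE. Qed.

Lemma ratl1 (c : 'rV[F]_3) i : c 0 i = 1 -> ratl c 0 i = 1.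
Proof. by move=> ci; rewrite mxE ci rmorph1. Qed.

Lemma ratl0 (c : 'rV[F]_3) i : c 0 i = 0 -> ratl c 0 i = 0.
Proof. by move=> ci; rewrite mxE ci rmorph0. Qed.

Lemma ratlD u v : ratl (u + v) = ratl u + ratl v.
Proof. exact: map_mxD. Qed.

Lemma ratlZ k u : ratl (k *: u) = k%:A *: ratl u.
Proof. exact: map_mxZ. Qed.

Lemma algA_inj (k m : F) : k%:A = m%:A :> L -> k = m.
Proof. exact: (fmorph_inj (in_alg L)). Qed.

(* The columns i, j form an identity submatrix, so the coordinates of a point of
   the line can be read off at i and j. *)
Lemma typeI_line_ratl (c1 c2 : 'rV[F]_3) (i j : 'I_3) :
  c1 0 i = 1 -> c1 0 j = 0 -> c2 0 i = 0 -> c2 0 j = 1 ->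
  typeI_line b (<[ratl c1 *m b]> + <[ratl c2 *m b]>)%VS.
Proof.
move=> c1i c1j c2i c2j.
have neq0 k (c : 'rV[F]_3) : c 0 k = 1 -> ratl c *m b != 0.
  move=> ck; rewrite mulmx_b_eq0 // ratl_eq0; apply: contra_eqN ck => /eqP ->.
  by rewrite mxE eq_sym oner_eq0.
have d10 := neq0 _ _ c1i; have d20 := neq0 _ _ c2j.
pose r a := c1 + a *: c2.
have ri a : r a 0 i = 1 by rewrite !mxE c1i c2i mulr0 addr0.
have rj a : r a 0 j = a by rewrite !mxE c1j c2j mulr1 add0r.
have r0 a := neq0 _ _ (ri a).
have c2N a : ratl c2 *m b \notin <[ratl (r a) *m b]>%VS.
  rewrite mem_vline_b //; apply/negP=> /vline_coord[k kE].
  have := kE i; rewrite (ratl0 c2i) (ratl1 (ri a)) mulr1 => k0.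
  by have /eqP := kE j; rewrite -k0 mul0r (ratl1 c2j) oner_eq0.
have rl a : (<[ratl (r a) *m b]> <= <[ratl c1 *m b]> + <[ratl c2 *m b]>)%VS.
  rewrite -memvE mem_add_lines_b; apply/memv_add_lines; exists 1, a%:A.
  by rewrite ratlD ratlZ scale1r.
split.
  rewrite addvC dim_add_lines // mem_vline_b //; apply/negP=> /vline_coord[k kE].
  by have /eqP := kE i; rewrite (ratl1 c1i) (ratl0 c2i) mulr0 oner_eq0.
(* The q + 1 points are [c2] and [c1 + a *: c2] for [a] in F. *)
exists (point_of (ratl c2 *m b) :: [seq point_of (ratl (r a) *m b) | a <- enum F]).
split; last 1 first.
- move=> P; rewrite !inE [RHS]unfold_in; apply/idP/idP.
    case/orP=> [/eqP -> | /mapP[a _ ->]]; rewrite val_point_of //; apply/andP; split.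
    + by apply/existsP; exists c2; rewrite val_point_of.
    + exact: addvSr.
    + by apply/existsP; exists (r a); rewrite val_point_of.
    + exact: rl.
  case/andP=> /existsP[c /eqP PE]; rewrite PE -memvE -/(ratl c) mem_add_lines_b.
  have c0 : ratl c != 0.
    by apply: contraTneq (valP P) => c0; rewrite PE -/(ratl c) c0 mul0mx dim_vline eqxx.
  case/memv_add_lines=> k [m cE].
  have kE : (c 0 i)%:A = k.
    by rewrite -ratlE cE comb_coord (ratl1 c1i) (ratl0 c2i) mulr1 mulr0 addr0.
  have mE : (c 0 j)%:A = m.
    by rewrite -ratlE cE comb_coord (ratl0 c1j) (ratl1 c2j) mulr1 mulr0 add0r.
  (* A row vanishing at [i] gives the point of [c2]; any other is scaled to have coordinate 1 at
     [i], hence the form [r a]. *)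
  have [ci0 | ci0] := eqVneq (c 0 i) 0.
    apply/orP; left; apply/eqP/val_inj; rewrite val_point_of // PE -/(ratl c) cE -kE.
    rewrite ci0 !scale0r add0r -scalemxAl vlineZ //; apply: contraNneq c0 => m0.
    by rewrite cE -kE ci0 m0 !scale0r addr0.
  apply/orP; right; apply/mapP; exists (c 0 j / c 0 i); first by rewrite mem_enum.
  apply/val_inj; rewrite val_point_of // PE -/(ratl c).
  have -> : ratl c = (c 0 i)%:A *: ratl (r (c 0 j / c 0 i)).
    rewrite -ratlZ scalerDr scalerA mulrC divfK // ratlD !ratlZ.
    by rewrite kE mE.
  by rewrite -scalemxAl vlineZ // scaler_eq0 oner_eq0 orbF.
- rewrite cons_uniq map_inj_uniq ?enum_uniq ?andbT.
    apply/mapP=> -[a _ /(congr1 val)]; rewrite !val_point_of // => E.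
    by have := c2N a; rewrite -E memv_line.
  move=> a a' /(congr1 val); rewrite !val_point_of // => E.
  have := memv_line (ratl (r a) *m b); rewrite E mem_vline_b // => /vline_coord[k kE].
  have := kE i; rewrite !ratl1 // mulr1 => k1.
  by have := kE j; rewrite !ratlE !rj -k1 mul1r => /algA_inj.
- by rewrite /= size_map -cardE.
Qed.

Variable t : 'End(L).
Hypotheses (dimL : \dim {:L} = 3%N) (t1 : t 1 != 0).
Hypothesis tM : forall a c, t a * t c = t (a * c) * t 1.
Hypothesis tau3 : forall a, tau t (tau t (tau t a)) = a.
Hypothesis tau_neq1 : exists a, tau t a != a.

Lemma rational_row (y : 'rV[L]_3) :
  map_mx (tau t) y = y -> exists c, y = ratl c.
Proof.
move=> /rowP ty.
have /fin_all_exists[c cE] i : exists k, y 0 i = k%:A.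
  by apply: (fixed_tau dimL t1 tM tau_neq1); have := ty i; rewrite mxE.
by exists (\row_i c i); apply/rowP=> i; rewrite !mxE cE.
Qed.

(* The reduced echelon basis of a tau-invariant line is fixed by tau. *)
Lemma rational_line (l : {vspace 'rV[L]_3}) : \dim l = 2%N ->
  {in l, forall u, map_mx (tau t) u \in l} ->
  exists (c1 c2 : 'rV[F]_3) (i j : 'I_3),
    [/\ c1 0 i = 1, c1 0 j = 0, c2 0 i = 0, c2 0 j = 1
      & l = (<[ratl c1]> + <[ratl c2]>)%VS].
Proof.
move=> diml tl.
have x0 : vpick l != 0 by rewrite vpick0 -dimv_eq0 diml.
have [i xi] := row_neq0 x0; pose x := (vpick l 0 i)^-1 *: vpick l.
have xl : x \in l by rewrite memvZ ?memv_pick.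
have x1 : x 0 i = 1 by rewrite mxE mulVf.
clearbody x; have /subvPn[y yl yx] : ~~ (l <= <[x]>)%VS.
  by apply/negP=> /dimvS; rewrite diml dim_vline; case: (x != 0).
(* Gaussian elimination; the coefficient 1 is kept so that [comb_coord] applies. *)
pose y' := 1 *: y + (- y 0 i) *: x.
have y'l : y' \in l by rewrite memvD ?memvZ.
have y'0 : y' != 0.
  apply: contraNneq yx => /eqP; rewrite /y' scale1r scaleNr subr_eq0 => /eqP ->.
  by rewrite memvZ ?memv_line.
have y'i : y' 0 i = 0 by rewrite comb_coord x1 mul1r mulr1 subrr.
clearbody y'; have [j yj] := row_neq0 y'0.
pose w2 := (y' 0 j)^-1 *: y'; pose w1 := 1 *: x + (- x 0 j) *: w2.
have w2l : w2 \in l by rewrite memvZ.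
have w2i : w2 0 i = 0 by rewrite mxE y'i mulr0.
have w2j : w2 0 j = 1 by rewrite mxE mulVf.
have w1l : w1 \in l by rewrite memvD // memvZ.
have w1i : w1 0 i = 1 by rewrite comb_coord w2i x1 mulr0 addr0 mulr1.
have w1j : w1 0 j = 0 by rewrite comb_coord w2j mul1r mulr1 subrr.
clearbody w1 w2.
have w1N : w1 \notin <[w2]>%VS.
  apply/negP=> /vline_coord[k /(_ i)/eqP].
  by rewrite w1i w2i mulr0 oner_eq0.
have w20 : w2 != 0 by apply: contra_eqN w2j => /eqP ->; rewrite mxE eq_sym oner_eq0.
have lE : l = (<[w1]> + <[w2]>)%VS.
  apply/esym/eqP; rewrite eqEdim subv_add -!memvE w1l w2l addvC dim_add_lines //.
  by rewrite diml.
(* A vector of [l] is determined by its coordinates at [i] and [j]; those of [w1] and [w2] are 0 and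
   1, which [tau] fixes. *)
have readl u : u \in l -> u = u 0 i *: w1 + u 0 j *: w2.
  rewrite lE => /memv_add_lines[k [m ->]].
  congr (_ *: _ + _ *: _); rewrite comb_coord ?w1i ?w2i ?w1j ?w2j; ring.
have [c1 c1E] : exists c, w1 = ratl c.
  apply: rational_row; rewrite {1}[map_mx _ _]readl ?tl // !mxE w1i w1j.
  by rewrite (tau1 t1) linear0 scale1r scale0r addr0.
have [c2 c2E] : exists c, w2 = ratl c.
  apply: rational_row; rewrite {1}[map_mx _ _]readl ?tl // !mxE w2i w2j.
  by rewrite (tau1 t1) linear0 scale1r scale0r add0r.
exists c1, c2, i, j; rewrite -c1E -c2E; split=> //.
- by apply: algA_inj; rewrite -ratlE -c1E w1i scale1r.
- by apply: algA_inj; rewrite -ratlE -c1E w1j scale0r.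
- by apply: algA_inj; rewrite -ratlE -c2E w2i scale0r.
- by apply: algA_inj; rewrite -ratlE -c2E w2j scale1r.
Qed.

End RationalLines.

(** * The kinds of fixed planes *)

Section FixedPlanes.

Variables (F : finFieldType) (L : fieldExtType F) (e : 3.-tuple L) (b : 'M[L]_3).
Hypotheses (dimL : \dim {:L} = 3%N) (e_basis : basis_of {:L} e).
Hypothesis b_unit : b \in unitmx.
Variables (phi : pg_point L 2 -> pg_point L 2) (sigma : 'End('rV[F]_9)).
Hypothesis phi_order : has_order phi 3.
Hypothesis phi_fix : forall P, subplane b P -> phi P = P.
Hypothesis sigma_inj : lker sigma = 0%VS.
Hypothesis sigma_phi :
  forall P, (sigma @: bose_plane e P)%VS = bose_plane e (phi P).
Variable t : 'End(L).
Hypothesis sigma_t : forall x, sigma (psi e b x) = psi e b (map_mx t x).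

Notation psi := (psi e b).
Notation unpsi := (unpsi e b).
Notation tr := (map_mx t : 'rV[L]_3 -> 'rV[L]_3).

Let t1 : t 1 != 0 := t1_neq0 e_basis b_unit sigma_inj sigma_t.
Let tM a c : t a * t c = t (a * c) * t 1 :=
  t_multiplicative e_basis b_unit sigma_inj sigma_phi sigma_t a c.
Let tau3 a : tau t (tau t (tau t a)) = a :=
  tau_cubed e_basis b_unit phi_order sigma_inj sigma_phi sigma_t a.
Let tau_neq1 : exists a, tau t a != a :=
  tau_neq_id e_basis b_unit phi_order sigma_inj sigma_phi sigma_t.
Let phiE P x (x0 : x != 0) (PE : val P = <[x *m b]>%VS) :
    val (phi P) = <[tr x *m b]>%VS :=
  phi_coord e_basis b_unit sigma_inj sigma_phi sigma_t x0 PE.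
Let trN0 x : x != 0 -> tr x != 0.
Proof. by rewrite (map_t_eq0 e_basis b_unit sigma_inj sigma_t). Qed.

Lemma map_tZ a x : tr (a *: x) = tau t a *: tr x.
Proof. by apply/rowP=> i; rewrite !mxE (t_mul t1 tM). Qed.

(** After scaling one coordinate to 1, the proportionality factor between [y] and its image is
    [t 1], so [tau] fixes every coordinate and they lie in F. *)
Lemma fixed_point_subplane P : phi P = P -> subplane b P.
Proof.
have [x x0 PE] := coord_pointP b_unit P => fixP.
have [i xi] := row_neq0 x0; pose y := (x 0 i)^-1 *: x.
have PEy : val P = <[y *m b]>%VS by rewrite PE -scalemxAl vlineZ ?invr_eq0.
have y0 : y != 0 by rewrite scaler_eq0 invr_eq0 negb_or xi.
have yi : y 0 i = 1 by rewrite mxE mulVf.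
have := phiE y0 PEy; rewrite fixP PEy => yE; clearbody y.
have : tr y \in <[y]>%VS by rewrite -(mem_vline_b b_unit) yE memv_line.
case/vline_coord=> k kE.
have kt : k = t 1 by have := kE i; rewrite mxE yi mulr1.
have [c yc] : exists c, y = ratl L c.
  apply: (rational_row dimL t1 tM tau_neq1); apply/rowP=> j; rewrite mxE.
  by apply: (mulfI t1); rewrite -(t_tau t1) -kt -kE mxE.
by apply/existsP; exists c; rewrite PEy yc.
Qed.

(** An orbit of a map of order 3 has one or three elements. *)
Lemma non_uniq_fixed P : ~~ uniq [:: P; phi P; phi (phi P)] -> phi P = P.
Proof.
have [_ phi3 _] := phi_order; have {}phi3 Q : phi (phi (phi Q)) = Q := phi3 Q.
apply: contraNeq => ne; rewrite /= !inE andbT negb_or eq_sym ne /=.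
apply/andP; split; apply: contraNneq ne => E; apply/eqP.
  by rewrite {1}E phi3.
by rewrite -{2}(phi3 P) -E -E.
Qed.

Lemma collinear_coord P x : x != 0 -> val P = <[x *m b]>%VS ->
  collinear (val P) (val (phi P)) (val (phi (phi P)))
  = (\dim (<[x *m b]> + <[tr x *m b]> + <[tr (tr x) *m b]>)%VS <= 2)%N.
Proof.
move=> x0 PE; have PE1 := phiE x0 PE; have PE2 := phiE (trN0 x0) PE1.
by rewrite /collinear PE PE1 PE2.
Qed.

Lemma typeII_coord P x : x != 0 -> val P = <[x *m b]>%VS -> typeII phi P ->
  tr x \notin <[x]>%VS /\ tr (tr x) \in (<[x]> + <[tr x]>)%VS.
Proof.
move=> x0 PE [uP]; rewrite (collinear_coord x0 PE) => col.
have nx : tr x \notin <[x]>%VS.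
  apply: contraTN uP => txx; suff PP : phi P = P by rewrite /= PP !inE eqxx.
  apply/val_inj/eqP; rewrite eqEdim (eqP (valP P)) (eqP (valP (phi P))) andbT.
  by rewrite (phiE x0 PE) PE -memvE mem_vline_b.
split=> //; rewrite -(mem_add_lines_b b_unit); apply: contraLR col => ttx.
by rewrite -ltnNge dim_addv_line // dim_add_lines // ?mulmx_b_eq0 // mem_vline_b.
Qed.

(** An F-dependence between [psi x] and its images under [sigma] is an L-dependence between [x] and
    its images under [tr]. In particular vectors over Type III points are cyclic. *)
Lemma noncyclic_collinear x :
  ~~ cyclic_vector sigma (psi x) ->
  (\dim (<[x *m b]> + <[tr x *m b]> + <[tr (tr x) *m b]>)%VS <= 2)%N.
Proof.
have le1 (u : 'rV[L]_3) : (\dim <[u]> <= 1)%N by rewrite dim_vline leq_b1.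
have le2 (u w : 'rV[L]_3) : (\dim (<[u]> + <[w]>) <= 2)%N.
  by apply: leq_trans (leq_add (le1 u) (le1 w)); rewrite -dimv_sum_cap leq_addr.
rewrite cyclic_vectorE negb_and !negbK !sigma_t => /orP[/memv_add_lines[k [m]]|/vlineP[k]].
  rewrite -!psiZ -psiD => /(psi_inj e_basis b_unit) E.
  suff /addv_idPl -> : (<[tr (tr x) *m b]> <= <[x *m b]> + <[tr x *m b]>)%VS by [].
  rewrite -memvE mem_add_lines_b // E; apply/memv_add_lines.
  by exists m%:A, k%:A; rewrite addrC.
rewrite -psiZ => /(psi_inj e_basis b_unit) E.
suff /addv_idPl -> : (<[tr x *m b]> <= <[x *m b]>)%VS by [].
by rewrite -memvE mem_vline_b // E memvZ ?memv_line.
Qed.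

Variable pi : {vspace 'rV[F]_9}.
Hypotheses (pi_plane : \dim pi = 3%N) (pi_fixed : (sigma @: pi)%VS = pi).

Let kind := plane_of_kind e b phi sigma pi.
Definition has_cyclic_vector :=
  [exists v : 'rV[F]_9, (v \in pi) && cyclic_vector sigma v].

Lemma pi_stable : {in pi, forall v, sigma v \in pi}.
Proof. by move=> v vpi; rewrite -pi_fixed memv_img. Qed.

Lemma ptwise_fixedP :
  ptwise_fixed sigma pi <-> {in pi, forall v, sigma v \in <[v]>%VS}.
Proof.
split=> [fix_pi v vpi | fix_pi B].
  have [-> | v0] := eqVneq v 0; first by rewrite linear0 mem0v.
  have := fix_pi (point_of v); rewrite val_point_of // -memvE => /(_ vpi).
  by rewrite limg_line => <-; rewrite memv_line.
have [v v0 ->] := pointP B; rewrite -memvE => /fix_pi sv.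
apply/eqP; rewrite limg_line eqEdim -memvE sv !dim_vline v0.
by rewrite (sigma_eq0 sigma_inj) v0.
Qed.

Lemma cyclic_pi v : v \in pi -> cyclic_vector sigma v ->
  pi = (<[v]> + <[sigma v]> + <[sigma (sigma v)]>)%VS.
Proof. by move=> vpi cv; apply: cyclic_span => //; exact: pi_stable. Qed.

(** The triangle condition on the point spanned by [psi x] is the cyclicity of [psi x]. *)
Lemma FixedIIP : kind FixedII <->
  exists x P, [/\ psi x \in pi, cyclic_vector sigma (psi x), x != 0,
    val P = <[x *m b]>%VS & typeII phi P].
Proof.
split=> [[B [[_ [P tP ->] BP] colB] Bpi] | [x [P [xpi cx x0 PE tP]]]].
  have [v v0 BE] := pointP B; rewrite BE -memvE in BP Bpi.
  rewrite BE !limg_line in colB.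
  rewrite -(unpsiK e_basis b_unit v) in v0 BP Bpi colB.
  move: (unpsi v) v0 BP Bpi colB => x; rewrite psi_eq0 // mem_bose_plane_psi //.
  move=> x0 xP xpi colx; exists x, P; split=> //; last first.
    by apply: point_eq_vline; rewrite ?mulmx_b_eq0.
  by rewrite cyclic_vector_dim ltnNge; apply/negP.
exists (point_of (psi x)); last first.
  by rewrite val_point_of ?psi_eq0.
split.
  exists (bose_plane e P); first by exists P.
  by rewrite val_point_of ?psi_eq0 // -memvE mem_bose_plane_psi // PE memv_line.
rewrite val_point_of ?psi_eq0 // !limg_line /collinear.
by apply/negP; rewrite -ltnNge -cyclic_vector_dim.
Qed.

Lemma FixedIIIP : kind FixedIII <->
  exists x P, [/\ psi x \in pi, x != 0, val P = <[x *m b]>%VS & typeIII phi P].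
Proof.
split=> [[B [_ [P tP ->] BP] Bpi] | [x [P [xpi x0 PE tP]]]].
  have [v v0 BE] := pointP B; rewrite BE -memvE in BP Bpi.
  rewrite -(unpsiK e_basis b_unit v) in v0 BP Bpi.
  move: (unpsi v) v0 BP Bpi => x; rewrite psi_eq0 // mem_bose_plane_psi //.
  move=> x0 xP xpi; exists x, P; split=> //.
  by apply: point_eq_vline; rewrite ?mulmx_b_eq0.
exists (point_of (psi x)); last first.
  by rewrite val_point_of ?psi_eq0.
exists (bose_plane e P); first by exists P.
by rewrite val_point_of ?psi_eq0 // -memvE mem_bose_plane_psi // PE memv_line.
Qed.

Lemma PtwiseFixed_noncyclic : kind PtwiseFixed -> ~~ has_cyclic_vector.
Proof.
move=> /ptwise_fixedP eig; apply/existsPn=> v; rewrite negb_and.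
by case: (boolP (v \in pi)) => // /eig /eigen_noncyclic ->.
Qed.

Lemma SIPlane_cyclic : kind SIPlane -> has_cyclic_vector.
Proof.
have [n n0 t3] := t_cube dimL t1 tM tau3 tau_neq1; case=> P PI piE.
have [v vP cv] := SI_plane_cyclic e_basis b_unit sigma_t t1 tM tau3 tau_neq1 n0 t3 PI.
by apply/existsP; exists v; rewrite piE vP.
Qed.

Lemma FixedII_cyclic : kind FixedII -> has_cyclic_vector.
Proof.
by move=> /FixedIIP[x [P [xpi cx _ _ _]]]; apply/existsP; exists (psi x); rewrite xpi.
Qed.

Lemma FixedIII_cyclic : kind FixedIII -> has_cyclic_vector.
Proof.
move=> /FixedIIIP[x [P [xpi x0 PE tP]]]; apply/existsP; exists (psi x).
rewrite xpi; apply/negP=> /negP/noncyclic_collinear.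
by rewrite -(collinear_coord x0 PE).
Qed.

(** A hwise-fixed 5-space is an image of some sigma - c, and the cofactor of [c] kills all its
    vectors. *)
Lemma HPlane_noncyclic : kind HPlane -> ~~ has_cyclic_vector.
Proof.
have [n n0 t3] := t_cube dimL t1 tM tau3 tau_neq1; case=> -[Pi hPi piPi] _.
have [c cn PiE] := hwise_is_image dimL e_basis b_unit sigma_t t1 tM tau3 tau_neq1 t3 hPi.
have s3 := sigma_cubed e_basis b_unit sigma_t t3.
apply/existsPn=> v; rewrite negb_and; case: (boolP (v \in pi)) => //= /(subvP piPi).
rewrite PiE => /memv_imgP[w _ ->]; rewrite sigma_subE.
exact: cofactor_noncyclic (cofactor_sub s3 _ cn).
Qed.

Lemma noncyclic_kind : ~~ has_cyclic_vector -> kind PtwiseFixed \/ kind HPlane.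
Proof.
have [n n0 t3] := t_cube dimL t1 tM tau3 tau_neq1; move=> /existsPn nc.
have {}nc : {in pi, forall v, ~~ cyclic_vector sigma v}.
  by move=> v vpi; have := nc v; rewrite vpi.
have [/forallP eig | /forallPn[v0]] :=
  boolP [forall v : 'rV[F]_9, (v \in pi) ==> (sigma v \in <[v]>%VS)].
  by left; apply/ptwise_fixedP => v vpi; have := eig v; rewrite vpi.
rewrite negb_imply => /andP[v0pi v0N]; right; split; last first.
  by move=> /ptwise_fixedP/(_ _ v0pi); apply/negP.
have s3 := sigma_cubed e_basis b_unit sigma_t t3.
have [c cn cP] := noncyclic_space s3 n0 pi_stable nc v0pi v0N.
exists (limg (sigma - c *: \1)%VF).
  exact: (hwise_image dimL e_basis b_unit sigma_t sigma_inj t1 tM tau3 tau_neq1 t3).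
apply/subvP=> v /cP.
exact: (cofactor_image dimL e_basis b_unit sigma_t t1 tM tau3 tau_neq1 t3).
Qed.

(** The type of the point [P] over which a cyclic vector lies decides. For Type I the plane of [P]
    is preserved by [sigma], so it contains the span of the cyclic vector and its images, which is
    [pi]. *)
Lemma cyclic_kind :
  has_cyclic_vector -> [\/ kind SIPlane, kind FixedII | kind FixedIII].
Proof.
case/existsP=> v /andP[]; rewrite -(unpsiK e_basis b_unit v).
move: (unpsi v) => x xpi cx.
have x0 : x != 0.
  apply: contraTneq cx => ->; rewrite psi0; apply: eigen_noncyclic.
  by rewrite linear0 mem0v.
pose P := point_of (x *m b); have PE : val P = <[x *m b]>%VS by rewrite val_coord_point.
have [col | ncol] := boolP (collinear (val P) (val (phi P)) (val (phi (phi P)))).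
  have [uP | /non_uniq_fixed fixP] := boolP (uniq [:: P; phi P; phi (phi P)]).
    by apply: Or32; apply/FixedIIP; exists x, P.
  apply: Or31; exists P; first exact: fixed_point_subplane.
  have sP w : w \in bose_plane e P -> sigma w \in bose_plane e P.
    by move=> wP; rewrite -{1}fixP -sigma_phi memv_img.
  have xP : psi x \in bose_plane e P by rewrite mem_bose_plane_psi // PE memv_line.
  apply/eqP; rewrite eqEdim pi_plane; apply/andP; split.
    by rewrite (cyclic_pi xpi cx) !subv_add -!memvE xP !sP // sP.
  by apply: leq_trans (dim_span _) _; rewrite size_map size_tuple.
by apply: Or33; apply/FixedIIIP; exists x, P; split=> //; apply/negP.
Qed.

Lemma bose_plane_coord P x : x != 0 -> psi x \in bose_plane e P ->
  val P = <[x *m b]>%VS.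
Proof.
move=> x0; rewrite mem_bose_plane_psi // => xP.
by apply: point_eq_vline; rewrite ?mulmx_b_eq0.
Qed.

(** Every nonzero vector of [bose_plane e P] lies over the point [P] alone, which is fixed by
    [phi]. *)
Lemma SIPlane_FixedII : kind SIPlane -> kind FixedII -> False.
Proof.
case=> P PI piE /FixedIIP[x [Q [xpi _ x0 QE [uQ _]]]]; rewrite piE in xpi.
have QP : Q = P by apply: val_inj; rewrite QE (bose_plane_coord x0 xpi).
by move: uQ; rewrite QP /= !(phi_fix PI) !inE eqxx.
Qed.

Lemma SIPlane_FixedIII : kind SIPlane -> kind FixedIII -> False.
Proof.
case=> P PI piE /FixedIIIP[x [Q [xpi x0 QE []]]]; rewrite piE in xpi.
have -> : Q = P by apply: val_inj; rewrite QE (bose_plane_coord x0 xpi).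
by rewrite /collinear !(phi_fix PI) !addvv (eqP (valP P)).
Qed.

Lemma FixedII_sub_line x : psi x \in pi -> cyclic_vector sigma (psi x) ->
  tr (tr x) \in (<[x]> + <[tr x]>)%VS ->
  (pi <= bose_space e (<[x *m b]> + <[tr x *m b]>))%VS.
Proof.
move=> xpi cx ttx; rewrite (cyclic_pi xpi cx) !sigma_t !subv_add -!memvE.
rewrite !mem_bose_space // !boseK // (subvP (addvSl _ _)) ?memv_line //.
by rewrite (subvP (addvSr _ _)) ?memv_line // mem_add_lines_b.
Qed.

(** The whole of [pi] lies over the line joining [x] and [tr x], so the conjugates of any point
    below [pi] are collinear. *)
Lemma FixedII_FixedIII : kind FixedII -> kind FixedIII -> False.
Proof.
move=> /FixedIIP[x [P [xpi cx x0 PE tP]]] /FixedIIIP[y [Q [ypi y0 QE tQ]]].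
have [tx ttx] := typeII_coord x0 PE tP.
have sub := subvP (FixedII_sub_line xpi cx ttx).
have styl := pi_stable ypi; have sstyl := pi_stable styl; rewrite !sigma_t in styl sstyl.
apply: tQ; rewrite (collinear_coord y0 QE).
have diml : \dim (<[x *m b]> + <[tr x *m b]>)%VS = 2%N.
  by rewrite dim_add_lines ?mulmx_b_eq0 ?mem_vline_b.
rewrite -[leqRHS]diml; apply: dimvS; rewrite !subv_add -!memvE.
move: (sub _ ypi) (sub _ styl) (sub _ sstyl).
by rewrite !mem_bose_space // !boseK // => -> -> ->.
Qed.

(** The line [l] joining [x] and [tr x] is invariant under [tau], hence spanned by two rows over F.
    For uniqueness, a line whose 5-space contains [pi] contains both points, so it is [l]. *)
Lemma FixedII_line : kind FixedII ->
  exists! Pi : {vspace 'rV[F]_9}, HI_5space e b Pi /\ (pi <= Pi)%VS.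
Proof.
move=> /FixedIIP[x [P [xpi cx x0 PE tP]]].
have [tx ttx] := typeII_coord x0 PE tP.
pose l := (<[x *m b]> + <[tr x *m b]>)%VS.
have diml : \dim l = 2%N by rewrite dim_add_lines ?mulmx_b_eq0 ?mem_vline_b.
have lI : typeI_line b l.
  have dim0 := dim_add_lines x0 tx.
  have [|c1 [c2 [i [j [c1i c1j c2i c2j lE]]]]] :=
      rational_line dimL t1 tM tau_neq1 dim0.
    move=> u /memv_add_lines[k [m ->]].
    (* As tau = t / t(1), invariance under [tau] amounts to invariance under [tr], which sends [x]
       to [tr x] and [tr x] back into the line. *)
    have -> : map_mx (tau t) (k *: x + m *: tr x) =
        (t 1)^-1 *: (tau t k *: tr x + tau t m *: tr (tr x)).
      by rewrite -!map_tZ; apply/rowP=> i; rewrite !mxE tauE linearD mulrC.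
    rewrite memvZ // memvD ?memvZ //.
    by rewrite (subvP (addvSr _ _)) ?memv_line.
  suff -> : l = (<[ratl L c1 *m b]> + <[ratl L c2 *m b]>)%VS.
    exact: typeI_line_ratl c1i c1j c2i c2j.
  apply/vspaceP=> u; rewrite -(mulmxKV b_unit u) !mem_add_lines_b //.
  by rewrite lE.
exists (bose_space e l); split.
  split; last exact: FixedII_sub_line.
  by exists l => //; apply/(bose_lineP e_basis).
move=> _ [[l' [diml' _] /(bose_lineP e_basis) ->] /subvP pil'].
congr (bose_space e _); apply/eqP; rewrite eqEdim diml diml' leqnn andbT.
have := pil' _ xpi; have := pil' _ (pi_stable xpi).
rewrite sigma_t !mem_bose_space // !boseK // subv_add -!memvE.
by move=> -> ->.
Qed.

(** The existence of a cyclic vector separates the S_I, fixed-II and fixed-III planes from the two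
    other kinds; within each group the kinds exclude one another. *)
Lemma fixed_plane_unique_kind : exists! k, kind k.
Proof.
have nP : kind PtwiseFixed -> ~ has_cyclic_vector by move/PtwiseFixed_noncyclic/negP.
have nH : kind HPlane -> ~ has_cyclic_vector by move/HPlane_noncyclic/negP.
have nPH : kind HPlane -> ~ kind PtwiseFixed by case.
have cI := SIPlane_cyclic; have cII := FixedII_cyclic; have cIII := FixedIII_cyclic.
have I_II := SIPlane_FixedII; have I_III := SIPlane_FixedIII.
have II_III := FixedII_FixedIII.
have uniq_kind k1 k2 : kind k1 -> kind k2 -> k1 = k2.
  by case: k1; case: k2 => // *; exfalso; tauto.
suff [k kk] : exists k, kind k by exists k; split=> // k'; apply: uniq_kind.
have [/cyclic_kind[] | /noncyclic_kind[]] := boolP has_cyclic_vector; by eexists; eauto.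
Qed.

End FixedPlanes.

Theorem theorem17 (F : finFieldType) (L : fieldExtType F)
  (q_gt2 : (2 < #|F|)%N) (dimL : \dim {:L} = 3%N)
  (b : 'M[L]_3) (b_unit : b \in unitmx)
  (phi : pg_point L 2 -> pg_point L 2)
  (phi_coll : collineation phi) (phi_order : has_order phi 3)
  (phi_fix : forall P, subplane b P -> phi P = P)
  (e : 3.-tuple L) (e_basis : basis_of {:L} e)
  (sigma : 'End('rV[F]_9)) (sigma_inj : lker sigma = 0%VS)
  (sigma_order : has_order (fun U : {vspace 'rV[F]_9} => (sigma @: U)%VS) 3)
  (sigma_phi : forall P, (sigma @: bose_plane e P)%VS = bose_plane e (phi P))
  (pi : {vspace 'rV[F]_9}) (pi_plane : \dim pi = 3%N)
  (pi_fixed : (sigma @: pi)%VS = pi) :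
  (exists! k : fixed_plane_kind, plane_of_kind e b phi sigma pi k)
  /\ (plane_of_kind e b phi sigma pi FixedII ->
      exists! Pi : {vspace 'rV[F]_9}, HI_5space e b Pi /\ (pi <= Pi)%VS).
Proof.
have [t sigma_t] := sigma_coordinates e_basis b_unit phi_fix sigma_phi.
split.
  exact: (fixed_plane_unique_kind dimL e_basis b_unit phi_order phi_fix
            sigma_inj sigma_phi sigma_t).
exact: (FixedII_line dimL e_basis b_unit phi_order sigma_inj sigma_phi sigma_t).
Qed.
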